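(* Let $\mathcal{L}$ be a language of continuous logic and let $\mathrm{T}$ be a complete $\mathcal{L}$-theory with $\chi(\mathrm{T},\mathcal{L}) \le \aleph_0$. Assume that there are a definable set $X$ relative to $\mathrm{T}$ and a (possibly definable) formula $\varphi(\bar x, \bar y)$ satisfying the following conditions: (1) $\varphi$ takes discrete values $\{0,1\}$ on $X$: for every $M \models \mathrm{T}$ and all $\bar a, \bar b \in X(M)$, $\varphi^M(\bar a, \bar b) \in \{0,1\}$. (2) $\varphi$ defines an asymmetric relation on $X$: for every $M \models \mathrm{T}$ and all $\bar a, \bar b \in X(M)$, if $\varphi^M(\bar a, \bar b) = 0$, then $\varphi^M(\bar b, \bar a) = 1$. (3) For every $M \models \mathrm{T}$, every $n < \omega$ and all $\bar a_i \in X(M)$ $(i < n)$, there exists $\bar b \in X(M)$ such that $\varphi^M(\bar a_i, \bar b) = 0$ for all $i < n$. Then, if the continuum hypothesis fails (i.e. $\aleph_1 < 2^{\aleph_0}$), there exist models $A, B \models \mathrm{T}$ with density characters at most $2^{\aleph_0}$ such that $A^{\mathcal{U}} \not\cong B^{\mathcal{V}}$ for all non-principal ultrafilters $\mathcal{U}, \mathcal{V}$ on $\omega$.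
   Context: The setting is standard continuous model theory of (many-sorted) metric structures: sorts are complete bounded metric spaces, function and predicate symbols are interpreted by uniformly continuous functions with moduli of uniform continuity (and bounds for predicates) prescribed by the language, and formulas are built from atomic formulas by continuous functions $\mathbb{R}^n\to\mathbb{R}$ and the quantifiers $\sup$ and $\inf$. The value $0$ plays the role of ''true'': a theory $\mathrm{T}$ is a set of sentences, and $M \models \mathrm{T}$ means $\sigma^M = 0$ for all $\sigma \in \mathrm{T}$. $\mathrm{T}$ is complete if it has a model and any two models of $\mathrm{T}$ assign the same value to every sentence. $\chi(\mathrm{T},\mathcal{L})$ is the density character of the set of $\mathcal{L}$-formulas with respect to the pseudometrics, one for each finite tuple $\bar x$ of variables, $d(\varphi,\psi) = \sup\{|\varphi^M(\bar a) - \psi^M(\bar a)| : M \models \mathrm{T},\ \bar a \in M\}$; so $\chi(\mathrm{T},\mathcal{L})\le\aleph_0$ means that there are countably many formulas such that every formula is a uniform limit, over all models of $\mathrm{T}$, of these. The density character of a metric structure is the least cardinality of a dense subset. A definable formula (definable predicate) relative to $\mathrm{T}$ is a uniform limit, over all models of $\mathrm{T}$, of formulas in a fixed tuple of variables (without parameters). A definable set $X$ relative to $\mathrm{T}$ is an assignment to each $M \models \mathrm{T}$ of a closed subset $X(M)$ of a fixed finite product of sorts of $M$ such that the distance function $\bar x \mapsto d(\bar x, X(M))$ is given, in all models $M$ of $\mathrm{T}$, by one and the same definable formula. In $\varphi(\bar x,\bar y)$, both $\bar x$ and $\bar y$ range over the finite product of sorts in which $X$ lives. For an ultrafilter $\mathcal{U}$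 on $\omega$, $M^{\mathcal{U}}$ denotes the metric ultrapower: each sort of $M^{\mathcal U}$ is the quotient of the set of sequences $(a_n)_{n<\omega}$ in that sort of $M$ by the relation $\lim_{n\to\mathcal{U}} d(a_n,b_n)=0$, with the symbols interpreted by $\mathcal{U}$-limits. $\cong$ is isomorphism of $\mathcal{L}$-structures. *)

(* Defs.v *)
(* A finite tuple of variables is a sequence of sorts ("context"); variables  *)
(* are well-sorted de Bruijn indices, and a quantifier binds the head of the  *)
(* context.  The value 0 means "true".                                        *)
From HB Require Import structures.
From mathcomp Require Import all_boot all_order all_algebra generic_quotient.
From mathcomp Require Import mathcomp_extra boolp classical_sets functions.
From mathcomp Require Import cardinality reals interval_inference.
From mathcomp Require Import topology normedtype sequences lra.

Set Implicit Arguments.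
Unset Strict Implicit.
Unset Printing Implicit Defensive.

Import Order.TTheory GRing.Theory Num.Theory.
Import numFieldNormedType.Exports.

Local Open Scope classical_set_scope.
Local Open Scope ring_scope.
Local Open Scope card_scope.

(* Complete metric spaces; as everywhere in the library, complete spaces are  *)
(* pointed, that is, nonempty.                                                *)
#[short(type="completeMetricType")]
HB.structure Definition CompleteMetric (R : numDomainType) :=
  {T of CompletePseudoMetric R T & Metric R T}.

Section Tuples.
Variables (R : realType) (S : Type).
Implicit Types C : S -> completeMetricType R.

Fixpoint tup C (G : seq S) : Type :=
  if G is s :: G' then (C s * tup C G')%type else unit.

Fixpoint tcat C (G D : seq S) :
    tup C G -> tup C D -> tup C (G ++ D) :=
  match G return tup C G -> tup C D -> tup C (G ++ D) with
  | [::] => fun _ y => y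
  | s :: G' => fun x y => (x.1, tcat x.2 y)
  end.

Fixpoint tmap C C' (h : forall s, C s -> C' s) (G : seq S) :
    tup C G -> tup C' G :=
  match G return tup C G -> tup C' G with
  | [::] => id
  | s :: G' => fun x => (h s x.1, tmap h x.2)
  end.

Inductive var : seq S -> S -> Type :=
| V0 s G : var (s :: G) s
| VS s t G : var G s -> var (t :: G) s.

Fixpoint lookup C G s (v : var G s) : tup C G -> C s :=
  match v in var G s return tup C G -> C s with
  | V0 _ _ => fun x => x.1
  | VS _ _ _ w => fun x => lookup w x.2
  end.

Fixpoint tdist C (G : seq S) :
    tup C G -> tup C G -> R :=
  match G return tup C G -> tup C G -> R with
  | [::] => fun _ _ => 0
  | s :: G' => fun x y => Num.max (mdist x.1 y.1) (tdist x.2 y.2)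
  end.

End Tuples.

(* The language prescribes a bound for the diameter of each sort, a modulus   *)
(* of uniform continuity for each symbol, and a bound for the absolute value  *)
(* of each predicate.                                                         *)
Record language (R : realType) := Language {
  lsort : Type;
  sbound : lsort -> R;
  fsym : Type;
  fdom : fsym -> seq lsort;
  fcod : fsym -> lsort;
  fmod : fsym -> {posnum R} -> {posnum R};
  psym : Type;
  pdom : psym -> seq lsort;
  pmod : psym -> {posnum R} -> {posnum R};
  pbound : psym -> R }.

Record structure (R : realType) (L : language R) := Structure {
  carrier :> lsort L -> completeMetricType R;
  fint : forall f : fsym L, tup carrier (fdom f) -> carrier (fcod f);
  pint : forall p : psym L, tup carrier (pdom p) -> R;
  sboundP : forall s (x y : carrier s), mdist x y <= sbound s;
  fmodP : forall f (e : {posnum R}) (x y : tup carrier (fdom f)),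
    tdist x y < (fmod f e)%:num -> mdist (fint x) (fint y) <= e%:num;
  pmodP : forall p (e : {posnum R}) (x y : tup carrier (pdom p)),
    tdist x y < (pmod p e)%:num -> `|pint x - pint y| <= e%:num;
  pboundP : forall p (x : tup carrier (pdom p)), `|pint x| <= pbound p }.

Arguments fint {R L} _ f _.
Arguments pint {R L} _ p _.

Section Logic.
Variables (R : realType) (L : language R).
Implicit Types (G : seq (lsort L)) (M N : structure L).

Inductive term G : lsort L -> Type :=
| Tvar s : var G s -> term G s
| Tfun (f : fsym L) : terms G (fdom f) -> term G (fcod f)
with terms G : seq (lsort L) -> Type :=
| Tnil : terms G [::]
| Tcons s D : term G s -> terms G D -> terms G (s :: D).

Inductive formula : seq (lsort L) -> Type :=
| Fdist G s : term G s -> term G s -> formula G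
| Fpred G (p : psym L) : terms G (pdom p) -> formula G
| Fconn G n (u : 'rV[R]_n -> R) :
    continuous u -> ('I_n -> formula G) -> formula G
| Fsup G s : formula (s :: G) -> formula G
| Finf G s : formula (s :: G) -> formula G.

Fixpoint term_eval M G (x : tup M G) s (t : term G s) : M s :=
  match t in term _ s return M s with
  | Tvar _ v => lookup v x
  | Tfun f ts => fint M f (terms_eval x ts)
  end
with terms_eval M G (x : tup M G) D (ts : terms G D) : tup M D :=
  match ts in terms _ D return tup M D with
  | Tnil => tt
  | Tcons _ _ t ts' => (term_eval x t, terms_eval x ts')
  end.

(* Carriers are nonempty and the values of a formula are bounded, so that the *)
(* real-valued [sup] and [inf] of the library are genuine bounds here.        *)
Fixpoint eval M G (phi : formula G) : tup M G -> R :=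
  match phi in formula G return tup M G -> R with
  | Fdist _ _ t1 t2 => fun x => mdist (term_eval x t1) (term_eval x t2)
  | Fpred _ p ts => fun x => pint M p (terms_eval x ts)
  | Fconn _ _ u _ phis => fun x => u (\row_i eval (phis i) x)
  | Fsup _ s psi => fun x => sup (range (fun a : M s => eval psi (a, x)))
  | Finf _ s psi => fun x => inf (range (fun a : M s => eval psi (a, x)))
  end.

Definition sentence := formula [::].
Definition theory := set sentence.

Definition models M (T : theory) :=
  forall sigma : sentence, T sigma -> eval (M := M) sigma tt = 0.

Definition complete_theory (T : theory) :=
  (exists M, models M T) /\
  forall M N (sigma : sentence), models M T -> models N T ->
    eval (M := M) sigma tt = eval (M := N) sigma tt.

(* chi(T, L) <= aleph_0.  There is one pseudometric per context G, so D has   *)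
(* to be dense in the formulas in each context; D is countable altogether.    *)
Definition countable_density (T : theory) :=
  exists2 D : forall G, set (formula G),
    countable [set p : {G & formula G} | D (projT1 p) (projT2 p)] &
    forall G (phi : formula G) (e : R), 0 < e ->
      exists2 psi, D G psi & forall M, models M T ->
        forall x : tup M G, `|eval phi x - eval psi x| <= e.

(* P M is only constrained when M is a model of T.                            *)
Definition definable_formula (T : theory) G
    (P : forall M, tup M G -> R) :=
  exists phi : nat -> formula G, forall e : R, 0 < e ->
    \forall n \near \oo, forall M, models M T ->
      forall x : tup M G, `|P M x - eval (phi n) x| <= e.

(* The junk value [inf set0 = 0] only matters for X empty.                    *)
Definition set_dist M G (x : tup M G) (X : set (tup M G)) : R :=
  inf [set tdist x y | y in X].

Definition tup_closed M G (X : set (tup M G)) :=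
  forall x, (forall e : R, 0 < e -> exists2 y, X y & tdist x y < e) -> X x.

Definition definable_set (T : theory) G (X : forall M, set (tup M G)) :=
  (forall M, models M T -> tup_closed (X M)) /\
  definable_formula T (fun M x => set_dist x (X M)).

Definition isomorphic M N :=
  exists h : forall s, M s -> N s, [/\
    forall s, bijective (h s),
    forall s (x y : M s), mdist (h s x) (h s y) = mdist x y,
    forall f (x : tup M (fdom f)), h _ (fint M f x) = fint N f (tmap h x) &
    forall p (x : tup M (pdom p)), pint N p (tmap h x) = pint M p x].

(* The least cardinality of a dense subset of M (all sorts together) is at    *)
(* most the cardinality of K.                                                 *)
Definition density_char_le M U (K : set U) :=
  exists2 D : forall s, set (M s),
    forall s, dense (D s) &
    [set p : {s & M s} | D (projT1 p) (projT2 p)] #<= K.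

End Logic.

(* 2^aleph_0 *)
Definition continuum : set (set nat) := setT.

Definition continuum_hypothesis :=
  forall A : set (set nat), countable A \/ A #= continuum.

Definition nonprincipal (U : set_system nat) := forall n, ~ U [set n].

Section UltraLimit.
Variables (R : realType) (U : set_system nat) (UU : UltraFilter U).

Definition ulim (u : nat -> R) : R := lim (u n @[n --> U]).

Lemma ulim_cvg (u : nat -> R) (b : R) :
  (forall n, `|u n| <= b) -> u n @[n --> U] --> ulim u.
Proof.
move=> ub; apply/cvg_ex => /=.
have uU : (u @ U) [set x | x \in `[- b, b]].
  by apply: (@filterE _ U) => n /=; rewrite in_itv/= -ler_norml.
have [l [_ clu]] := @segment_compact R (- b) b (u @ U) _ uU; exists l => A /= nA.
have [//|UA] := in_ultra_setVsetC (u @^-1` A) UU.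
have [y [/= Ay nAy]] : (~` A) `&` A !=set0 by apply: clu.
by [].
Qed.

Lemma ulim_eq (u : nat -> R) l : u n @[n --> U] --> l -> ulim u = l.
Proof. exact: cvg_lim. Qed.

Lemma ulim_le (u v : nat -> R) (bu bv : R) :
  (forall n, `|u n| <= bu) -> (forall n, `|v n| <= bv) ->
  (\forall n \near U, u n <= v n) -> ulim u <= ulim v.
Proof.
by move=> /ulim_cvg ul /ulim_cvg vl uv; exact: (ler_cvg_to ul vl).
Qed.

Lemma ulim_lt (u : nat -> R) (b c : R) : (forall n, `|u n| <= b) ->
  ulim u < c -> \forall n \near U, u n < c.
Proof. by move=> /ulim_cvg ul uc; apply: (cvgr_lt _ ul). Qed.

End UltraLimit.

Lemma small_geometric (R : realType) (a eps : R) :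
  0 < eps -> exists m, a * 2^-1 ^+ m < eps.
Proof.
move=> eps0; have := @cvg_geometric R a 2^-1.
rewrite ger0_norm// invf_lt1// ltr1n => /(_ isT) /cvgr_lt /(_ _ eps0) aE.
by have [m /=] := filter_ex aE; exists m.
Qed.

Lemma geometric_limit (R : realType) (T : completeMetricType R)
    (c : nat -> T) :
  (forall m, mdist (c m) (c m.+1) <= 2 * 2^-1 ^+ m) ->
  exists l, forall m, mdist (c m) l <= 4 * 2^-1 ^+ m.
Proof.
move=> cS.
have cD m p : mdist (c m) (c (m + p)%N) <= 4 * 2^-1 ^+ m.
  elim: p m => [|p IH] m; first by rewrite addn0 mdistxx mulr_ge0.
  rewrite addnS -addSn (le_trans (metric_triangle _ (c m.+1) _))//.
  rewrite (le_trans (lerD (cS m) (IH m.+1)))// exprS.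
  by rewrite mulrA -mulrDl ler_wpM2r// ?exprn_ge0//; lra.
have /cvg_ex[l cl] : cvg (c n @[n --> \oo]).
  apply: cauchy_cvg; apply: cauchy_exP => eps eps0.
  have [m em] := small_geometric 4 eps0.
  exists (c m); exists m => // n /= mn.
  by rewrite ballEmdist/= -(subnKC mn) (le_lt_trans (cD _ _)).
exists l => m; apply/ler_addgt0Pr => eps eps0.
have /metricType_numDomainType.cvgrPdist_lt/(_ _ eps0)[N _ Nl] := cl.
rewrite (le_trans (metric_triangle _ (c (m + N)%N) _))// lerD//.
by rewrite metric_sym ltW//; apply: Nl; exact: leq_addl.
Qed.

Section UltrapowerSort.
Variables (R : realType) (T : completeMetricType R) (b : R).
Variable Tb : forall x y : T, mdist x y <= b.
Variables (U : set_system nat) (UU : UltraFilter U).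
Implicit Types u v w : nat -> T.

Let dbound u v n : `|mdist (u n) (v n)| <= b.
Proof. by rewrite ger0_norm ?mdist_ge0. Qed.

Let udist u v := ulim U (fun n => mdist (u n) (v n)).

Let udist_cvg u v : mdist (u n) (v n) @[n --> U] --> udist u v.
Proof. exact: ulim_cvg (dbound u v). Qed.

Let udistxx u : udist u u = 0.
Proof.
apply: ulim_eq; under eq_fun do rewrite mdistxx.
exact: cvg_cst.
Qed.

Let udist_sym u v : udist u v = udist v u.
Proof. by congr ulim; apply/funext => n; rewrite metric_sym. Qed.

Let udist_triangle v u w : udist u w <= udist u v + udist v w.
Proof.
have uvw : mdist (u n) (v n) + mdist (v n) (w n) @[n --> U] -->
    udist u v + udist v w by apply: cvgD; exact: udist_cvg.
rewrite -(ulim_eq UU uvw).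
apply: (@ulim_le _ _ UU _ _ b (b + b)) => //.
  by move=> n; rewrite (le_trans (ler_normD _ _))// lerD.
by apply: (@filterE _ U) => n; exact: metric_triangle.
Qed.

Let udist_ge0 u v : 0 <= udist u v.
Proof.
have := udist_triangle v u u; rewrite udistxx (udist_sym v).
by rewrite -mulr2n pmulrn_lge0.
Qed.

(* The sort of the ultrapower is the quotient of nat -> T by [ueq].           *)
Definition ueq : rel (nat -> T) := fun u v =>
  `[< mdist (u n) (v n) @[n --> U] --> (0 : R) >].

Lemma ueqE u v : ueq u v = (udist u v == 0).
Proof.
apply/asboolP/eqP => [|<-]; [exact: ulim_eq|exact: udist_cvg].
Qed.

Lemma ueq_refl : reflexive ueq.
Proof. by move=> u; rewrite ueqE udistxx. Qed.

Lemma ueq_sym : symmetric ueq.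
Proof. by move=> u v; rewrite !ueqE udist_sym. Qed.

Lemma ueq_trans : transitive ueq.
Proof.
move=> v u w; rewrite !ueqE => /eqP uv /eqP vw.
by rewrite eq_le udist_ge0 andbT (le_trans (udist_triangle v _ _))// uv vw addr0.
Qed.

Canonical ueq_equiv := EquivRel ueq ueq_refl ueq_sym ueq_trans.

Definition usort := {eq_quot ueq_equiv}%qT.

HB.instance Definition _ := Choice.on usort.

Definition upi u : usort := (\pi_({eq_quot ueq_equiv}) u)%qT.

Definition urepr (x : usort) : nat -> T := repr x.

Lemma ureprK x : upi (urepr x) = x.
Proof. exact: reprK. Qed.

Lemma upiP u v :
  upi u = upi v <-> mdist (u n) (v n) @[n --> U] --> (0 : R).
Proof.
split=> [/eqP|uv]; first by rewrite /upi eqmodE => /asboolP.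
by apply/eqP; rewrite /upi eqmodE; exact/asboolP.
Qed.

Let qdist (x y : usort) := udist (urepr x) (urepr y).

Let qdist_pi u v : qdist (upi u) (upi v) = udist u v.
Proof.
have qE w : udist w (urepr (upi w)) = 0.
  by apply/ulim_eq/upiP; rewrite ureprK.
have aux w1 w2 w3 w4 : udist w1 w3 = 0 -> udist w2 w4 = 0 ->
    udist w1 w2 <= udist w3 w4.
  move=> e1 e2; rewrite (le_trans (udist_triangle w3 _ _))// e1 add0r.
  by rewrite (le_trans (udist_triangle w4 _ _))// (udist_sym w4) e2 addr0.
by apply/eqP; rewrite eq_le /qdist !aux ?qE// udist_sym qE.
Qed.

Let qdist_positivity x y : qdist x y = 0 -> x = y.
Proof.
by move=> xy0; rewrite -(ureprK x) -(ureprK y); apply/upiP; rewrite -xy0.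
Qed.

HB.instance Definition _ := @isMetric.Build R usort qdist
  (fun x => udistxx _) qdist_positivity (fun x y => udist_sym _ _)
  (fun y x z => udist_triangle _ _ _).

HB.instance Definition _ := isPointed.Build usort (upi (fun=> point)).

Lemma mdist_upi u v :
  mdist (upi u : usort) (upi v) = ulim U (fun n => mdist (u n) (v n)).
Proof. exact: qdist_pi. Qed.

Lemma usort_bound (x y : usort) : mdist x y <= b.
Proof.
have <- : ulim U (fun=> b) = b by apply: ulim_eq; exact: cvg_cst.
apply: (@ulim_le _ _ UU _ _ b `|b|) => //.
by apply: (@filterE _ U) => n; exact: Tb.
Qed.

Lemma usort_complete (F : set_system usort) :
  ProperFilter F -> cauchy F -> cvg F.
Proof.
move=> FF /cauchyP Fc; pose e k : R := 2^-1 ^+ k.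
have e0 k : 0 < e k by rewrite exprn_gt0.
have eS k : e k = 2 * e k.+1 by rewrite /e exprS mulrA divff ?mul1r.
have /choice[x xF] : forall k, exists x, F (ball x (e k)) by move=> k; exact: Fc.
pose a k := urepr (x k).
pose good n k := mdist (a k n) (a k.+1 n) < 2 * e k.
have goodU k : \forall n \near U, good n k.
  apply: (ulim_lt UU (dbound (a k) (a k.+1))).
  rewrite -mdist_upi !ureprK.
  have [y []] := filter_ex (filterI (xF k) (xF k.+1)).
  rewrite !ballEmdist/= => xy x'y.
  rewrite (le_lt_trans (metric_triangle _ y _))// (metric_sym y).
  by rewrite mulrDl mul1r ltrD// (lt_le_trans x'y)// (eS k) ler_peMl ?ler1n ?ltW.
pose c n := fix c m := if m is m'.+1
  then if `[< forall k, (k < m'.+1)%N -> good n k >] then a m n else c m'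
  else a 0%N n.
have cE n m : (forall k, (k < m)%N -> good n k) -> c n m = a m n.
  by case: m => // m gm /=; rewrite asboolT.
have cS n m : mdist (c n m) (c n m.+1) <= 2 * e m.
  rewrite /=; case: asboolP => [gm|_]; last by rewrite mdistxx mulr_ge0// ltW.
  by rewrite cE => [|k km]; [exact/ltW/gm|exact/gm/ltnW].
have /choice[l lP] : forall n, exists l, forall m, mdist (c n m) l <= 4 * e m.
  by move=> n; exact: geometric_limit.
have xl m : mdist (x m) (upi l) <= 4 * e m.
  rewrite -(ureprK (x m)) mdist_upi.
  have <- : ulim U (fun=> 4 * e m) = 4 * e m by apply: ulim_eq; exact: cvg_cst.
  apply: (@ulim_le _ _ UU _ _ b `|4 * e m|) => //.
  have : \forall n \near U, forall k, (k < m)%N -> good n k.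
    elim: m => [|m IH]; first exact: filterE.
    near=> n => k; rewrite ltnS leq_eqVlt => /predU1P[->|].
      by near: n; exact: goodU.
    by move: k; near: n.
  by apply: filterS => n gm; have := lP n m; rewrite cE.
apply/cvg_ex; exists (upi l : usort).
apply/(@metricType_numDomainType.cvgrPdist_lt _ usort _ _ _ id) => eps eps0.
have [m em] : exists m, 5 * e m < eps by exact: small_geometric.
apply: filterS (xF m) => y; rewrite ballEmdist/= => xy.
rewrite (le_lt_trans (metric_triangle _ (x m) _))// (le_lt_trans _ em)//.
by rewrite -[5]/(4 + 1)%:R natrD mulrDl mul1r metric_sym lerD// ltW.
Unshelve. all: by end_near. Qed.

HB.instance Definition _ := Uniform_isComplete.Build usort usort_complete.

End UltrapowerSort.

Section Ultrapower.
Variables (R : realType) (L : language R) (M : structure L).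
Variables (U : set_system nat) (UU : UltraFilter U).

Definition ucarrier (s : lsort L) : completeMetricType R :=
  usort (@sboundP R L M s) UU.

Fixpoint tpi G : (nat -> tup M G) -> tup ucarrier G :=
  match G return (nat -> tup M G) -> tup ucarrier G with
  | [::] => fun=> tt
  | s :: G' => fun u => (upi (@sboundP R L M s) UU (fun n => (u n).1),
                         tpi (fun n => (u n).2))
  end.

Fixpoint trepr G : tup ucarrier G -> nat -> tup M G :=
  match G return tup ucarrier G -> nat -> tup M G with
  | [::] => fun _ _ => tt
  | s :: G' => fun x n => (urepr x.1 n, trepr x.2 n)
  end.

Lemma treprK G (x : tup ucarrier G) : tpi (trepr x) = x.
Proof.
elim: G x => [[]//|s G IH] [x1 x2] /=; congr pair; last exact: IH.
exact: ureprK.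
Qed.

Lemma tdist_ge0 G (x y : tup M G) : 0 <= tdist x y.
Proof. by elim: G x y => //= s G IH x y; rewrite le_max mdist_ge0. Qed.

Lemma tdist_tpi G (u v : nat -> tup M G) :
  tdist (u n) (v n) @[n --> U] --> tdist (tpi u) (tpi v).
Proof.
elim: G u v => [|s G IH] u v /=; first exact: cvg_cst.
rewrite mdist_upi; apply: continuous2_cvg; [|apply: ulim_cvg|exact: IH].
  exact: (@max_continuous _ R (_, _)).
by move=> n; rewrite ger0_norm ?mdist_ge0//; exact: sboundP.
Qed.

Lemma tdist_near G (u v : nat -> tup M G) (d : {posnum R}) :
  tdist (tpi u) (tpi v) < d%:num -> \forall n \near U, tdist (u n) (v n) < d%:num.
Proof. by move=> uv; apply: (cvgr_lt _ (@tdist_tpi G u v)). Qed.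

Definition ufint f (x : tup ucarrier (fdom f)) : ucarrier (fcod f) :=
  upi _ UU (fun n => fint M f (trepr x n)).

Definition upint p (x : tup ucarrier (pdom p)) : R :=
  ulim U (fun n => pint M p (trepr x n)).

Let fint_cvg f (u v : nat -> tup M (fdom f)) (e : {posnum R}) :
  tdist (tpi u) (tpi v) < (fmod f e)%:num ->
  mdist (upi (@sboundP R L M _) UU (fun n => fint M f (u n)) : ucarrier _)
    (upi _ UU (fun n => fint M f (v n))) <= e%:num.
Proof.
move=> /tdist_near uv; rewrite mdist_upi.
have <- : ulim U (fun=> e%:num) = e%:num by apply: ulim_eq; exact: cvg_cst.
apply: (@ulim_le _ _ UU _ _ (sbound (fcod f)) e%:num) => //.
- by move=> n; rewrite ger0_norm ?mdist_ge0//; exact: sboundP.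
- by move=> n; rewrite ger0_norm.
- by apply: filterS uv => n; exact: fmodP.
Qed.

Let pint_cvg p (u v : nat -> tup M (pdom p)) (e : {posnum R}) :
  tdist (tpi u) (tpi v) < (pmod p e)%:num ->
  `|ulim U (fun n => pint M p (u n)) - ulim U (fun n => pint M p (v n))|
    <= e%:num.
Proof.
move=> /tdist_near uv.
have pc w : pint M p (w n) @[n --> U] --> ulim U (fun n => pint M p (w n)).
  by apply: ulim_cvg => n; exact: pboundP.
apply: (ler_cvg_to (cvg_norm (cvgB (pc u) (pc v))) (cvg_cst e%:num)).
by apply: filterS uv => n; exact: pmodP.
Qed.

Let tpi_eq0 G (x y : tup ucarrier G) : x = y -> tdist x y = 0.
Proof.
by move=> ->; elim: G y {x} => //= s G IH y; rewrite mdistxx IH maxxx.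
Qed.

(* The interpretations do not depend on the choice of representatives.        *)
Lemma ufint_tpi f (u : nat -> tup M (fdom f)) :
  ufint (tpi u) = upi _ UU (fun n => fint M f (u n)).
Proof.
apply: mdist_positivity; apply/eqP; rewrite eq_le mdist_ge0 andbT.
apply/ler_addgt0Pr => e e0; rewrite add0r.
by apply: (@fint_cvg f _ _ (PosNum e0)); rewrite tpi_eq0// treprK.
Qed.

Lemma upint_tpi p (u : nat -> tup M (pdom p)) :
  upint (tpi u) = ulim U (fun n => pint M p (u n)).
Proof.
apply/eqP; rewrite -subr_eq0 -normr_le0.
apply/ler_addgt0Pr => e e0; rewrite add0r.
by apply: (@pint_cvg p _ _ (PosNum e0)); rewrite tpi_eq0// treprK.
Qed.

Let ufmodP f (e : {posnum R}) (x y : tup ucarrier (fdom f)) :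
  tdist x y < (fmod f e)%:num -> mdist (ufint x) (ufint y) <= e%:num.
Proof. by rewrite -{1}(treprK x) -{1}(treprK y); exact: fint_cvg. Qed.

Let upmodP p (e : {posnum R}) (x y : tup ucarrier (pdom p)) :
  tdist x y < (pmod p e)%:num -> `|upint x - upint y| <= e%:num.
Proof. by rewrite -{1}(treprK x) -{1}(treprK y); exact: pint_cvg. Qed.

Let upboundP p (x : tup ucarrier (pdom p)) : `|upint x| <= pbound p.
Proof.
have pc : pint M p (trepr x n) @[n --> U] --> upint x.
  by apply: ulim_cvg => n; exact: pboundP.
apply: (ler_cvg_to (cvg_norm pc) (cvg_cst (pbound p))).
by apply: (@filterE _ U) => n; exact: pboundP.
Qed.

Definition ultrapower : structure L := @Structure R L ucarrier ufint upint
  (fun s => @usort_bound R _ _ (@sboundP R L M s) U UU) ufmodP upmodP upboundP.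

End Ultrapower.

(* Main.v *)
(* The model A carries an omega_1-sequence in [X A] such that every element   *)
(* of [X A] is [phi]-below all late terms, and B one of length omega_2.  Such *)
(* sequences survive, as constant sequences, in ultrapowers over [nat], since *)
(* countable sets of indices are bounded.  They cannot coexist in one model:  *)
(* some term of the second would lie above every term of the first, against   *)
(* asymmetry.  When CH fails, both orders live inside the power set of [nat]. *)
(*                                                                            *)
(* Given W, start from a separable model M and a sequence [g] in [X M] which  *)
(* eventually dominates every element of [X M].  An independent family yields *)
(* functions [rho_w : nat -> nat] and an ultrafilter along which [rho_w]      *)
(* outgrows every function of finitely many [rho_v] with [v < w].  In the     *)
(* ultrapower of M, the classes of all sequences [h (rho_w1, ..., rho_wm)],   *)
(* where arbitrary [h] serve as Skolem functions, are dense in an elementary  *)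
(* substructure of density at most 2^aleph_0, and the classes of [g (rho_w)]  *)
(* are the required sequence indexed by W.                                    *)
From mathcomp Require Import all_boot all_order all_algebra.
From mathcomp Require Import boolp classical_sets functions cardinality wochoice.
From mathcomp Require Import reals interval_inference topology normedtype.
From mathcomp Require Import sequences lra.
From HB Require Import structures.
Require Import Defs.

Set Implicit Arguments.
Unset Strict Implicit.
Unset Printing Implicit Defensive.

Import Order.TTheory GRing.Theory Num.Theory.
Import numFieldNormedType.Exports.

Local Open Scope classical_set_scope.
Local Open Scope ring_scope.
Local Open Scope card_scope.

(** * Well-orders on the power set of the natural numbers *)

(** The two ultrapowers are told apart by the possible lengths of a [scale]: a family in [X] such
    that every point of [X] is [phi]-below all late terms. [not_CH_orders] turns the failure of CH
    into index sets [W1] and [W2] of subsets of [nat], and [model_with_scale] builds over either one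
    a model of density at most continuum with a scale. That construction rests on
    [dominating_sequence] (in a separable model, condition (3) applied to finite pieces of a
    countable dense part of [X] yields an omega-sequence above every point) and on
    [fast_growing_ultrafilter], which stretches this sequence along the index set.

    [scale_ultrapower] preserves a scale in nonprincipal ultrapowers over [nat], and
    [scale_surjective] under isomorphism. An isomorphism would thus put scales over both index sets
    into one model, which [scales_incompatible] excludes. Since [phi] is discrete on [X], [phi_near]
    lets approximate points of a metric structure give exact instances of [phi]. *)

Definition strict_well_order T (lt : T -> T -> Prop) :=
  (forall x y, [\/ lt x y, x = y | lt y x]) /\
  (forall P : set T, P !=set0 -> exists2 x, P x & forall y, lt y x -> ~ P y).

Lemma strict_well_order_exists (T : eqType) :
  exists lt : T -> T -> Prop, strict_well_order lt.
Proof.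
have [r rwo] := well_ordering_principle T.
have {}rwo : wo_chain r predT by move=> A _; exact: rwo.
have r_total x y : r x y || r y x by exact: (wo_chainW rwo).
have r_anti x y : r x y -> r y x -> x = y.
  by move=> xy yx; apply: (wo_chain_antisymmetric rwo) => //; rewrite xy yx.
exists (fun x y => r x y /\ x <> y); split=> [x y|P [x Px]].
  have [->|/eqP xy] := eqVneq x y; first by constructor 2.
  have /orP[rxy|ryx] := r_total x y; first by constructor 1.
  by constructor 3; split=> // /esym.
have [|z [[/asboolP Pz zP] _]] := rwo [pred x | `[< P x >]] (fun _ _ => isT).
  by exists x; exact/asboolP.
exists z => // y [yz nyz] Py; apply: nyz; apply: r_anti => //.
exact/zP/asboolP.
Qed.

Section WellOrder.
Variables (T : Type) (lt : T -> T -> Prop).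
Hypothesis lt_wo : strict_well_order lt.

(** A failure would produce a cycle among [x], [y] and [z], and a cycle has no minimal element. *)
Lemma swo_trans x y z : lt x y -> lt y z -> lt x z.
Proof.
move=> xy yz; have [//|xz|zx] := lt_wo.1 x z.
- have [|u] := lt_wo.2 [set x; y]; first by exists x; left.
  by case=> -> nlt; [case: (nlt y); [rewrite xz|right]|case: (nlt x); [|left]].
- have [|u] := lt_wo.2 [set t | [\/ t = x, t = y | t = z]].
    by exists x; constructor 1.
  case=> -> nlt.
  + by case: (nlt z) => //; constructor 3.
  + by case: (nlt x) => //; constructor 1.
  + by case: (nlt y) => //; constructor 2.
Qed.

Lemma swo_wf : well_founded lt.
Proof.
move=> x; apply: contrapT => nx.
have [|y ny y_min] := lt_wo.2 [set x | ~ Acc lt x]; first by exists x.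
by apply: ny; constructor => z zy; apply: contrapT => /(y_min _ zy).
Qed.

(** Recursion without dependent types: [step] receives an ordinary function, cut off to the default
    [b0] outside the segment of [x]. *)
Lemma swo_rec (B : Type) (b0 : B) (step : (T -> B) -> T -> B) :
  exists f, forall x, f x = step (fun y => if `[< lt y x >] then f y else b0) x.
Proof.
pose F x (rec : forall y, lt y x -> B) := step (fun y =>
  match pselect (lt y x) with left yx => rec y yx | right _ => b0 end) x.
exists (Fix swo_wf (fun=> B) F) => x; rewrite Fix_eq.
  congr step; apply/funext => y.
  by case: pselect => yx; [rewrite asboolT|rewrite asboolF].
move=> y f g fg; congr step; apply/funext => z.
by case: pselect => // zy; rewrite fg.
Qed.

Definition segment x := [set y | lt y x].

(* Taking [P] to be a cardinality bound, these are initial ordinals. *)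
Definition short_segments (P : set T -> Prop) := [set x | P (segment x)].

(** The least point outside [short_segments P] has its whole segment inside; if the latter satisfied
    [P], so would the segment, and the point would belong to it. *)
Lemma short_segments_large (P : set T -> Prop) :
  (forall A B, A `<=` B -> P B -> P A) -> ~ P setT -> ~ P (short_segments P).
Proof.
move=> Psub PT PW; have [|x xW xmin] := lt_wo.2 (~` short_segments P).
  apply: contrapT => nW; apply: PT; apply: Psub PW => x _; apply: contrapT => nx.
  by apply: nW; exists x.
by apply: xW; apply: Psub PW => y /xmin; exact: contrapT.
Qed.

(** Regularity: some point of [short_segments P] is neither in [Z] nor below a member of [Z], so by
    trichotomy it is above all of [Z]. *)
Lemma short_segments_bounded (P : set T -> Prop) (Z : set T) :
  (forall A B, A `<=` B -> P B -> P A) -> ~ P (short_segments P) ->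
  P (Z `|` \bigcup_(z in Z) segment z) ->
  exists2 w, short_segments P w & forall z, Z z -> lt z w.
Proof.
move=> Psub PW PZ; apply: contrapT => nw; apply: PW; apply: Psub PZ => w Ww.
apply: contrapT => /not_orP[nZw nw']; apply: nw; exists w => // z Zz.
have [//|zw|wz] := lt_wo.1 z w; first by rewrite -zw in nZw.
by case: nw'; exists z.
Qed.

End WellOrder.

(** * Cardinal arithmetic of omega_1 *)

Lemma card_leE T (U : pointedType) (A : set T) (B : set U) :
  A #<= B <-> exists2 f : T -> U, set_fun A B f & set_inj A f.
Proof. by split=> [/pcard_leP/injfunPex|/injfunPex/pcard_leP]. Qed.

Lemma card_bigcup_le I T (U : pointedType) (D : set I) (F : I -> set T)
    (A : set U) : A `*` A #<= A -> D #<= A ->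
  (forall i, D i -> F i #<= A) -> \bigcup_(i in D) F i #<= A.
Proof.
move=> AA /card_leE[e eA e_inj] FA; apply: card_le_trans AA.
elim/Ppointed: I => I in D F e eA e_inj FA *.
  by rewrite emptyE bigcup_set0 card_ge0.
have /choice[f fP] : forall i, exists f : T -> U,
    D i -> set_fun (F i) A f /\ set_inj (F i) f.
  move=> i; have [Di|nDi] := pselect (D i); last by exists (fun=> point).
  by have /card_leE[f fA f_inj] := FA i Di; exists f.
pose i x := xget point [set i | D i /\ F i x].
have iP x : (\bigcup_(i in D) F i) x -> D (i x) /\ F (i x) x.
  by move=> [j Dj Fjx]; apply: (@xgetPex _ point [set i | D i /\ F i x]); exists j.
apply/card_leE; exists (fun x => (e (i x), f (i x) x)).
  by move=> x /iP[Di Fi]; split => /=; [exact: eA|exact: (fP _ Di).1].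
move=> x y /set_mem/iP[Dx Fx] /set_mem/iP[Dy Fy] [eE fE].
have ixy : i x = i y by apply: e_inj => //; rewrite inE.
by apply: (fP _ Dx).2; rewrite ?inE// ?fE ixy.
Qed.

Section OmegaOne.
Variables (T : pointedType) (lt : T -> T -> Prop).
Hypothesis lt_wo : strict_well_order lt.
Hypothesis T_uncountable : ~ countable [set: T].

Let W := short_segments lt (@countable T).

Let countable_sub (A B : set T) : A `<=` B -> countable B -> countable A.
Proof. by move=> AB; apply: sub_countable; exact: subset_card_le. Qed.

Let W_uncountable : ~ countable W.
Proof. exact: (short_segments_large lt_wo (P := @countable T)). Qed.

(** By recursion along [lt], each [w] receives an injective sequence in [S] that avoids the
    sequences of all earlier points; these use up only countably many elements. The factor [nat] is
    what the square below needs. *)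
Lemma omega_one_nat_le (U : pointedType) (S : set U) :
  ~ countable S -> W `*` [set: nat] #<= S.
Proof.
move=> S_unc.
pose good (g : T -> nat -> U) w := [set h : nat -> U |
  [/\ injective h, forall n, S (h n) &
    forall y, lt y w -> forall n m, h n <> g y m]].
have [f fE] := swo_rec lt_wo (fun=> point)
  (fun g w => xget (fun=> point) (good g w)).
have fP w : W w -> good f w (f w).
  move=> Ww; pose g y := if `[< lt y w >] then f y else fun=> point.
  have -> : good f w = good g w.
    apply/seteqP; split=> h [h1 h2 h3]; split=> // y yw n m.
      by rewrite /g asboolT//; exact: h3.
    by have := h3 y yw n m; rewrite /g asboolT.
  rewrite fE; apply: xgetPex.
  have : infinite_set (S `\` \bigcup_(y in segment lt w) range (g y)).
    move=> /finite_set_countable cD; apply: S_unc.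
    apply: (@sub_countable _ _ _ ((S `\` \bigcup_(y in segment lt w) range (g y))
      `|` \bigcup_(y in segment lt w) range (g y))).
      by apply: subset_card_le => x Sx; case: (pselect
        ((\bigcup_(y in segment lt w) range (g y)) x)); [right|left].
    rewrite -bigcup2E; apply: bigcup_countable => // -[|[|i]] _ //=.
    apply: bigcup_countable => // y _.
    by apply: (sub_countable (card_image_le _ _)); exact: countableP.
  move=> /infiniteP/card_leE[h hS h_inj]; exists h; split.
  - by move=> n m /h_inj; apply; rewrite inE.
  - by move=> n; have [] := hS n Logic.I.
  - by move=> y yw n m hn; have [_] := hS n Logic.I; apply; exists y => //; exists m.
apply/card_leE; exists (fun p => f p.1 p.2).
  by move=> [w n] [/= /fP[]].
move=> [w n] [v m] /set_mem[/= /fP[wi _ wl] _] /set_mem[/= /fP[vi _ vl] _] /= fwv.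
have [/vl/(_ _ _ (esym fwv))//|wv|/wl/(_ _ _ fwv)//] := lt_wo.1 w v.
by subst v; rewrite (wi _ _ fwv).
Qed.

Lemma omega_one_le (U : pointedType) (S : set U) : ~ countable S -> W #<= S.
Proof.
move=> /omega_one_nat_le; apply: card_le_trans.
by apply/card_leE; exists (fun w => (w, 0%N)) => // x y _ _ [].
Qed.

(** A pair is coded by its larger entry [m] and the numbers of both entries in an enumeration of the
    countable segment up to and including [m]; this lands in the product of [W] and [nat]. *)
Lemma omega_one_square_le : W `*` W #<= W.
Proof.
apply: card_le_trans (omega_one_nat_le W_uncountable).
have /choice[e eP] : forall w, exists e : T -> nat, W w ->
    set_inj (segment lt w `|` [set w]) e.
  move=> w; have [Ww|nWw] := pselect (W w); last by exists (fun=> 0%N).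
  have : countable (segment lt w `|` [set w]).
    rewrite -bigcup2E; apply: bigcup_countable => // -[|[|i]] _ /=.
    - exact: Ww.
    - exact: countable1.
    - exact: countable0.
  by move=> /card_leE[e _ e_inj]; exists e.
pose m p := if `[< lt p.1 p.2 >] then p.2 else p.1 : T.
apply/card_leE.
exists (fun p => (m p, pickle (e (m p) p.1, e (m p) p.2))).
  by move=> [x y] [/= Wx Wy]; split=> //; rewrite /m; case: ifP.
have mP p : (segment lt (m p) `|` [set m p]) p.1 /\
    (segment lt (m p) `|` [set m p]) p.2.
  rewrite /m /segment; case: asboolP => [?|np]; split; [by left|by right|by right|].
  by have [//|->|?] := lt_wo.1 p.1 p.2; [right|left].
have mW p : W p.1 -> W p.2 -> W (m p) by rewrite /m; case: asboolP.
move=> p q /set_mem[Wp1 Wp2] /set_mem[_ _] [mpq].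
move=> /(pcan_inj pickleK)[e1 e2].
have [p1 p2] := mP p; have [q1 q2] := mP q.
rewrite -mpq in e1 e2 q1 q2.
have e_inj := eP _ (mW p Wp1 Wp2).
rewrite (surjective_pairing p) (surjective_pairing q).
by congr pair; apply: e_inj; rewrite ?inE.
Qed.

End OmegaOne.

(* [W1] and [W2] play the roles of [omega_1] and [omega_2] inside the power   *)
(* set of [nat].                                                              *)
Lemma not_CH_orders : ~ continuum_hypothesis ->
  exists (lt : set nat -> set nat -> Prop) (W1 W2 : set (set nat)),
  [/\ strict_well_order lt,
      forall Z, Z `<=` W1 -> countable Z ->
        exists2 w, W1 w & forall z, Z z -> lt z w,
      forall Z, Z `<=` W2 -> countable Z ->
        exists2 w, W2 w & forall z, Z z -> lt z w &
      forall Z, Z `<=` W2 -> Z #<= W1 ->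
        exists2 w, W2 w & forall z, Z z -> lt z w].
Proof.
move=> nCH; have [lt lt_wo] := @strict_well_order_exists (set nat).
have [S S_unc nSC] : exists2 S : set (set nat), ~ countable S & ~ (S #= continuum).
  apply: contrapT => nS; apply: nCH => A; apply: contrapT => /not_orP[cA nA].
  by apply: nS; exists A.
have sub_unc (A B : set (set nat)) : A `<=` B -> countable B -> countable A.
  by move=> AB; apply: sub_countable; exact: subset_card_le.
have C_unc : ~ countable [set: set nat].
  by move=> cC; apply: S_unc; exact: sub_unc cC.
pose W1 := short_segments lt (@countable (set nat)).
have W1_unc : ~ countable W1.
    exact: (short_segments_large lt_wo (P := @countable (set nat))).
have W1_W1 : W1 `*` W1 #<= W1 by exact: omega_one_square_le.
have countable_W1 U (Z : set U) : countable Z -> Z #<= W1.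
  move=> cZ; apply: card_le_trans cZ _; apply/infiniteP => fW.
  exact/W1_unc/finite_set_countable.
pose W2 := short_segments lt (fun A => A #<= W1).
have W1_sub (A B : set (set nat)) : A `<=` B -> B #<= W1 -> A #<= W1.
  by move=> /subset_card_le; exact: card_le_trans.
(* [W1] embeds into the intermediate set [S], so a continuum of size at most [W1] would be
   equinumerous with [S] by Cantor-Bernstein. *)
have nCW1 : ~ ([set: set nat] #<= W1).
  move=> CW1; apply: nSC; rewrite card_eq_le; apply/andP; split.
    exact: subset_card_le.
  exact/(card_le_trans CW1)/omega_one_le.
have nW2 : ~ (W2 #<= W1) by exact: (short_segments_large lt_wo (P := fun A => A #<= W1)).
have W2_bound Z : Z `<=` W2 -> Z #<= W1 -> exists2 w, W2 w & forall z, Z z -> lt z w.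
  move=> ZW ZW1; apply: (short_segments_bounded lt_wo W1_sub nW2).
  rewrite -bigcup2E; apply: (card_bigcup_le W1_W1); first exact: countable_W1.
  case=> [|[|i]] _ /=.
  - exact: ZW1.
  - by apply: (card_bigcup_le W1_W1 ZW1) => z /ZW.
  - exact: card_ge0.
exists lt, W1, W2; split=> // [Z ZW cZ|Z ZW cZ]; last exact/W2_bound/countable_W1.
apply: (short_segments_bounded lt_wo sub_unc W1_unc).
rewrite -bigcup2E; apply: bigcup_countable => // -[|[|i]] _ /=.
- exact: cZ.
- by apply: bigcup_countable => // z /ZW.
- exact: countable0.
Qed.

(** * Ultrafilters with fast growing functions *)

(* The index [i] codes a finite list of pairs of an initial segment of the    *)
(* characteristic function of a set and the value of [rho i] there.           *)
Lemma independent_functions :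
  exists rho : nat -> set nat -> nat, forall (f : set nat -> nat)
    (ws : seq (set nat)), exists i, {in ws, rho i =1 f}.
Proof.
pose init (w : set nat) n := mkseq (fun k => `[< w k >]) n.
pose rho i (w : set nat) := if @unpickle (nat * seq (seq bool * nat))%type i
  is Some (n, l) then nth 0%N (map snd l) (index (init w n) (map fst l)) else 0%N.
exists rho => f ws.
(* Some length [n] exceeds, for any two distinct sets of the finite list, a place where they differ,
   so initial segments of length [n] tell them apart. *)
have [n nP] : exists n, {in ws &, injective (init^~ n)}.
  have /choice[d dP] : forall p : set nat * set nat,
      exists k, p.1 <> p.2 -> `[< p.1 k >] <> `[< p.2 k >].
    move=> [v w]; apply: contrapT => nk; apply: (nk); exists 0%N; case.
    apply/seteqP; split=> k /asboolP vk; apply/asboolP; apply: contrapT => wk;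
      apply: nk; exists k => _; rewrite vk => /esym; [exact: wk|].
    by move=> /esym.
  exists (\max_(p <- [seq (v, w) | v <- ws, w <- ws]) (d p).+1) => v w vs ws' vw.
  apply: contrapT => /(dP (v, w)); apply => /=.
  have : (d (v, w) < \max_(p <- [seq (v, w) | v <- ws, w <- ws]) (d p).+1)%N.
    by apply: (@leq_bigmax_seq _ _ (fun=> true) (fun p => (d p).+1)) => //;
      exact: allpairs_f.
  move=> lt_d; have := congr1 (fun s => nth false s (d (v, w))) vw.
  by rewrite !nth_mkseq.
exists (pickle (n, [seq (init w n, f w) | w <- ws])) => w w_ws.
rewrite /rho pickleK -!map_comp /=.
set g := fun w => init w n.
have -> : map (fst \o (fun w => (init w n, f w))) ws = map g ws by [].
have i_lt : (index (g w) (map g ws) < size ws)%N.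
  by rewrite -(size_map g) index_mem map_f.
rewrite (nth_map set0)//=; congr f; apply: nP => //; first exact: mem_nth.
rewrite -/(g _) -(nth_map set0 [::])// nth_index//.
by apply/mapP; exists w.
Qed.

Lemma ultrafilter_exists_of_fip (T C : Type) (sat : C -> set T) :
  (forall cs : seq C, exists x, forall c, List.In c cs -> sat c x) ->
  exists2 U : set_system T, UltraFilter U & forall c, U (sat c).
Proof.
move=> fip; pose F := [set A : set T | exists cs : seq C,
  forall x, (forall c, List.In c cs -> sat c x) -> A x].
have FF : ProperFilter F.
  apply: Build_ProperFilter_ex.
    by move=> A [cs csA]; have [x /csA Ax] := fip cs; exists x.
  split.
  - by exists [::].
  - move=> A B [cs csA] [ds dsB]; exists (cs ++ ds) => x xP; split.
      by apply: csA => c cc; apply/xP/List.in_or_app; left.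
    by apply: dsB => c cc; apply/xP/List.in_or_app; right.
  - by move=> A B AB [cs csA]; exists cs => x /csA/AB.
have [U [UU FU]] := ultraFilterLemma FF.
by exists U => // c; apply: FU; exists [:: c] => x; apply; left.
Qed.

(* Finitely many of the required inequalities are met by choosing the values  *)
(* of [rho i] by recursion along [lt].                                        *)
Lemma fast_growing_ultrafilter (lt : set nat -> set nat -> Prop) :
  strict_well_order lt ->
  exists (rho : nat -> set nat -> nat) (U : set_system nat), UltraFilter U /\
    forall w (ws : seq (set nat)) (H : seq nat -> nat),
      (forall v, v \in ws -> lt v w) ->
      U [set i | (H (map (rho i) ws) <= rho i w)%N].
Proof.
move=> lt_wo; have [rho rhoP] := independent_functions; exists rho.
pose C := {c : set nat * seq (set nat) * (seq nat -> nat) |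
  forall v, v \in c.1.2 -> lt v c.1.1}.
pose sat (c : C) := let: (w, ws, H) := sval c in
  [set i | (H (map (rho i) ws) <= rho i w)%N].
have [cs|U UU UC] := @ultrafilter_exists_of_fip _ _ sat; last first.
  exists U; split=> // w ws H ltH.
  exact: (UC (exist _ (w, ws, H) ltH)).
(* The maximum runs over all constraints, also those about other sets, which only enlarges [f]. In a
   constraint about [w] every argument lies below [w], where the cut-off to 0 changes nothing. *)
have [f fE] := swo_rec lt_wo 0%N (fun g w =>
  \max_(c <- cs) (sval c).2 (map g (sval c).1.2)).
have [i iP] := rhoP f (flatten [seq (sval c).1.1 :: (sval c).1.2 | c <- cs]).
exists i => c cc.
have cP v : v \in (sval c).1.1 :: (sval c).1.2 -> rho i v = f v.
  move=> vc; apply: iP; apply/flattenP; exists ((sval c).1.1 :: (sval c).1.2) => //.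
  elim: (cs) cc => //= a l IH [->|/IH]; rewrite inE ?eqxx// => ->.
  by rewrite orbT.
case: c cc cP => -[[w ws] H] ltw cc /= cP; rewrite /sat/= [rho i w]cP ?mem_head//.
pose g y := if `[< lt y w >] then f y else 0%N; rewrite fE -/g.
have -> : map (rho i) ws = map g ws.
  apply/eq_in_map => v vws; rewrite cP; last by rewrite inE vws orbT.
  by rewrite /g asboolT//; apply: (ltw v vws).
elim: (cs) cc => //= a l IH [->|/IH]; rewrite big_cons; first exact: leq_maxl.
by move=> /leq_trans; apply; exact: leq_maxr.
Qed.

(** * Ultrapowers and limits of values of formulas *)

Section RangeSup.
Variables (R : realType) (T : pointedType) (b : R) (f : T -> R).
Hypothesis fb : forall x, `|f x| <= b.

Lemma has_sup_range : has_sup (range f).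
Proof.
split; first by exists (f point), point.
by exists b => _ [x _ <-]; rewrite (le_trans (ler_norm _)).
Qed.

Lemma le_sup_range x : f x <= sup (range f).
Proof. by apply: ub_le_sup; [case: has_sup_range|exists x]. Qed.

Lemma sup_range_near (e : R) : 0 < e -> exists x, sup (range f) <= f x + e.
Proof.
move=> e0; have [_ [x _ <-] fx] := sup_adherent e0 has_sup_range.
by exists x; rewrite -lerBlDr ltW.
Qed.

Lemma sup_range_le c : (forall x, f x <= c) -> sup (range f) <= c.
Proof.
by move=> fc; apply: ge_sup => [|_ [x _ <-]]; first by exists (f point), point.
Qed.

Lemma norm_sup_range : `|sup (range f)| <= b.
Proof.
rewrite ler_norml (le_trans _ (le_sup_range point)) ?sup_range_le// => [x|].
  by rewrite (le_trans (ler_norm _)).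
by rewrite lerNl (le_trans _ (fb point))// -normrN ler_norm.
Qed.

End RangeSup.

Lemma inf_range (R : realType) T (f : T -> R) :
  inf (range f) = - sup (range (fun x => - f x)).
Proof.
congr (- sup _); apply/seteqP; split=> [_ [_ [x _ <-] <-]|_ [x _ <-]].
  by exists x.
by exists (f x) => //; exists x.
Qed.

Lemma ulim_cvg_unique (R : realType) (U : set_system nat) (UU : UltraFilter U)
    (u : nat -> R) (l l' : R) :
  u n @[n --> U] --> l -> u n @[n --> U] --> l' -> l = l'.
Proof. by move=> /(ulim_eq UU) <- /(ulim_eq UU) <-. Qed.

Scheme term_mut := Induction for term Sort Prop
  with terms_mut := Induction for terms Sort Prop.

Section Eval.
Variables (R : realType) (L : language R).
Implicit Types (M N : structure L) (G D : seq (lsort L)).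

Lemma eval_bounded M G (phi : formula G) :
  exists b : R, forall x : tup M G, `|eval phi x| <= b.
Proof.
elim: G / phi => [G s t1 t2|G p ts|G n u cu phis IH|G s psi [b IH]|G s psi [b IH]].
- by exists (sbound s) => x /=; rewrite ger0_norm ?mdist_ge0//; exact: sboundP.
- by exists (pbound p) => x; exact: pboundP.
- have /choice[b bP] := IH.
  (* [u] is merely continuous, but its arguments stay in a compact box by induction. *)
  have : compact (u @` [set v : 'rV[R]_n | forall i, v ord0 i \in `[- b i, b i]]).
    apply: continuous_compact; first exact: continuous_subspaceT.
    by apply: (@rV_compact _ _ (fun i => [set` `[- b i, b i]])) => i;
      exact: segment_compact.
  move=> uc; have [c [_ cP]] := compact_bounded uc.
  exists (c + 1) => x /=; apply: (cP (c + 1)); first by rewrite ltrDl.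
  by exists (\row_i eval (phis i) x) => // i; rewrite mxE /= in_itv/= -ler_norml.
- exists b => x /=; apply: norm_sup_range => a; exact: IH.
- exists b => x /=; rewrite inf_range normrN; apply: norm_sup_range => a.
  by rewrite normrN.
Qed.

Lemma cvg_row (U : set_system nat) (UU : UltraFilter U) n
    (f : nat -> 'I_n -> R) (l : 'I_n -> R) :
  (forall i, f k i @[k --> U] --> l i) ->
  \row_i f k i @[k --> U] --> \row_i l i.
Proof.
move=> fl; apply/cvg_mx_entourageP => A entA.
have : \forall k \near U, forall i, A (l i, f k i).
  apply: (@filter_forall _ _ (fun i k => A (l i, f k i))) => i.
  by have /cvg_app_entourageP/(_ A entA) := fl i.
by apply: filterS => k fk i j; rewrite !mxE inE.
Qed.

Section Los.
Variables (M : structure L) (U : set_system nat) (UU : UltraFilter U).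
Notation MU := (ultrapower M UU).

Lemma lookup_tpi G s (v : var G s) (u : nat -> tup M G) :
  lookup v (tpi UU u : tup MU G) = upi _ UU (fun n => lookup v (u n)).
Proof. by elim: v u => //= {}s t {}G v IH u; rewrite IH. Qed.

Lemma terms_eval_tpi G D (ts : terms G D) (u : nat -> tup M G) :
  terms_eval (tpi UU u : tup MU G) ts = tpi UU (fun n => terms_eval (u n) ts).
Proof.
apply: (@terms_mut R L G (fun s t => term_eval (tpi UU u : tup MU G) t =
  upi _ UU (fun n => term_eval (u n) t)) (fun D ts =>
  terms_eval (tpi UU u : tup MU G) ts = tpi UU (fun n => terms_eval (u n) ts))).
- by move=> s v; exact: lookup_tpi.
- by move=> f {}ts IH /=; rewrite IH; exact: ufint_tpi.
- by [].
- by move=> s {}D t IHt {}ts IHts /=; rewrite IHt IHts.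
Qed.

Lemma term_eval_tpi G s (t : term G s) (u : nat -> tup M G) :
  term_eval (tpi UU u : tup MU G) t = upi _ UU (fun n => term_eval (u n) t).
Proof. by case: (terms_eval_tpi (Tcons t (Tnil G)) u). Qed.

(** Every point upstairs is the class of a sequence, which bounds the supremum of [g] by the limit
    of the suprema; conversely, the class of a sequence of near-maximizers nearly attains that
    limit. *)
Let sup_los (T T' : pointedType) (pi : (nat -> T) -> T') (b : R)
    (f : nat -> T -> R) (g : T' -> R) :
  (forall n x, `|f n x| <= b) -> (forall y, exists v, y = pi v) ->
  (forall v, f n (v n) @[n --> U] --> g (pi v)) ->
  sup (range (f n)) @[n --> U] --> sup (range g).
Proof.
move=> fb pi_surj fg.
have sb n : `|sup (range (f n))| <= b by exact: norm_sup_range.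
suff -> : sup (range g) = ulim U (fun n => sup (range (f n))) by exact: ulim_cvg sb.
have gb y : `|g y| <= b.
  have [v ->] := pi_surj y; apply: (ler_cvg_to (cvg_norm (fg v)) (cvg_cst b)).
  by apply: (@filterE _ U) => n; exact: fb.
apply/eqP; rewrite eq_le; apply/andP; split.
  apply: sup_range_le => y; have [v ->] := pi_surj y.
  apply: (ler_cvg_to (fg v) (ulim_cvg UU sb)).
  by apply: (@filterE _ U) => n; exact: le_sup_range (fb n) _.
apply/ler_addgt0Pr => e e0.
have /choice[v vP] : forall n, exists x, sup (range (f n)) <= f n x + e.
  by move=> n; exact: sup_range_near (fb n) _ e0.
have := le_sup_range gb (pi v); rewrite -(lerD2r e); apply: le_trans.
apply: (ler_cvg_to (ulim_cvg UU sb) (cvgD (fg v) (cvg_cst e))).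
by apply: (@filterE _ U) => n; exact: vP.
Qed.

(** The form as convergence along [U] lets continuous connectives pass through directly; both
    quantifiers reduce to [sup_los]. *)
Theorem los G (phi : formula G) (u : nat -> tup M G) :
  eval phi (u n) @[n --> U] --> eval phi (tpi UU u : tup MU G).
Proof.
elim: G / phi u => [G s t1 t2|G p ts|G n f cf phis IH|G s psi IH|G s psi IH] u /=.
- rewrite !term_eval_tpi mdist_upi; apply: (@ulim_cvg R U UU _ (sbound s)) => n.
  by rewrite ger0_norm ?mdist_ge0//; exact: sboundP.
- rewrite terms_eval_tpi; have -> := upint_tpi UU.
  by apply: (@ulim_cvg R U UU _ (pbound p)) => n; exact: pboundP.
- apply: (cvg_comp (fun k => \row_i eval (phis i) (u k)) f _ (cf _)).
  by apply: cvg_row => i; exact: IH.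
- have [b bP] := eval_bounded M psi.
  apply: (@sup_los (M s) (MU s) (@upi R (M s) _ _ U UU) b
    (fun n a => eval psi (a, u n)) (fun a => eval psi (a, tpi UU u : tup MU G))).
  + by move=> n x; exact: bP.
  + by move=> y; exists (urepr y); rewrite ureprK.
  + by move=> v; exact: (IH (fun n => (v n, u n))).
- under eq_fun do rewrite inf_range.
  rewrite inf_range; apply: cvgN; have [b bP] := eval_bounded M psi.
  apply: (@sup_los (M s) (MU s) (@upi R (M s) _ _ U UU) b
    (fun n a => - eval psi (a, u n))
    (fun a => - eval psi (a, tpi UU u : tup MU G))).
  + by move=> n x; rewrite normrN.
  + by move=> y; exists (urepr y); rewrite ureprK.
  + by move=> v; apply: cvgN; exact: (IH (fun n => (v n, u n))).
Qed.

End Los.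
End Eval.

Arguments los {R L M U} UU {G} phi u.

(** * Uniform continuity, elementary maps and definability *)

Section TupleDistance.
Variables (R : realType) (L : language R).
Implicit Types (M N : structure L) (G : seq (lsort L)).

Lemma tdistxx M G (x : tup M G) : tdist x x = 0.
Proof. by elim: G x => //= s G IH x; rewrite mdistxx IH maxxx. Qed.

Lemma tdist_sym M G (x y : tup M G) : tdist x y = tdist y x.
Proof. by elim: G x y => //= s G IH x y; rewrite metric_sym IH. Qed.

Lemma tdist_triangle M G (y x z : tup M G) :
  tdist x z <= tdist x y + tdist y z.
Proof.
elim: G x y z => [|s G IH] x y z /=; first by rewrite addr0.
rewrite ge_max (le_trans (metric_triangle _ y.1 _))/= ?lerD ?le_max ?lexx//.
by rewrite (le_trans (IH _ y.2 _))// lerD// le_max lexx orbT.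
Qed.

Lemma tdist_eq0 M G (x y : tup M G) : tdist x y = 0 -> x = y.
Proof.
elim: G x y => [[] []//|s G IH] [x1 x2] [y1 y2] /= xy0.
have := lexx (0 : R); rewrite -{1}xy0 ge_max => /andP[xy1 xy2].
congr pair; first by apply: mdist_positivity; apply/eqP; rewrite eq_le xy1 mdist_ge0.
by apply: IH; apply/eqP; rewrite eq_le xy2 tdist_ge0.
Qed.

Lemma tdist_tcat M G D (x x' : tup M G) (y y' : tup M D) :
  tdist (tcat x y) (tcat x' y') = Num.max (tdist x x') (tdist y y').
Proof.
elim: G x x' => [x x'|s G IH x x'] /=; first by rewrite max_r// tdist_ge0.
by rewrite IH maxA.
Qed.

Lemma tmap_tcat M N (h : forall s, M s -> N s) G D (x : tup M G) (y : tup M D) :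
  tmap h (tcat x y) = tcat (tmap h x) (tmap h y).
Proof. by elim: G x => //= s G IH x; rewrite IH. Qed.

Lemma tpi_tcat M (U : set_system nat) (UU : UltraFilter U) G D
    (u : nat -> tup M G) (v : nat -> tup M D) :
  tpi UU (fun n => tcat (u n) (v n)) = tcat (tpi UU u) (tpi UU v).
Proof. by elim: G u => //= s G IH u; rewrite IH. Qed.

Section SetDistance.
Variables (M : structure L) (G : seq (lsort L)) (X : set (tup M G)).
Hypothesis X0 : X !=set0.

Let has_inf_dist x : has_inf [set tdist x y | y in X].
Proof.
have [y Xy] := X0; split; first by exists (tdist x y), y.
by exists 0 => _ [z _ <-]; exact: tdist_ge0.
Qed.

Lemma set_dist_le x y : X y -> set_dist x X <= tdist x y.
Proof. by move=> Xy; apply: ge_inf; [case: (has_inf_dist x)|exists y]. Qed.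

Lemma set_dist_ge0 x : 0 <= set_dist x X.
Proof.
apply: lb_le_inf; first by case: (has_inf_dist x).
by move=> _ [y _ <-]; exact: tdist_ge0.
Qed.

Lemma set_dist_near x (e : R) :
  0 < e -> exists2 y, X y & tdist x y < set_dist x X + e.
Proof.
move=> e0; have [_ [y Xy <-] xy] := inf_adherent e0 (has_inf_dist x).
by exists y.
Qed.

Lemma set_dist_eq0 x : tup_closed X -> X x <-> set_dist x X = 0.
Proof.
move=> Xc; split=> [Xx|x0].
  by apply/eqP; rewrite eq_le set_dist_ge0 -(tdistxx x) set_dist_le.
apply: Xc => e e0; have [y Xy] := set_dist_near x e0.
by rewrite x0 add0r; exists y.
Qed.

End SetDistance.
End TupleDistance.

Lemma nonprincipal_ge (U : set_system nat) (UU : UltraFilter U) (N : nat) :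
  nonprincipal U -> U [set n | (N <= n)%N].
Proof.
move=> nU; elim: N => [|N IH]; first exact: filterE.
have [UN|UN] := in_ultra_setVsetC [set N] UU; first by have := nU N.
apply: filterS (filterI IH UN) => n /= [Nn nN].
by rewrite ltn_neqAle Nn andbT; apply/eqP => /esym.
Qed.

Lemma nonprincipal_cvg (R : realType) (U : set_system nat) (UU : UltraFilter U)
    (f : nat -> R) (l : R) :
  nonprincipal U -> f n @[n --> \oo] --> l -> f n @[n --> U] --> l.
Proof.
move=> nU fl A /fl [N _ NA].
exact: (@filterS _ U _ _ _ NA (nonprincipal_ge UU N nU)).
Qed.

Lemma nonprincipal_exists :
  exists2 U : set_system nat, UltraFilter U & nonprincipal U.
Proof.
have [U [UU oU]] := @ultraFilterLemma nat \oo _.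
exists U => // n Un; have : U [set m | (n < m)%N] by apply: oU; exists n.+1.
move=> /(filterI Un) /filter_ex[m [-> /=]]; rewrite ltnn//.
Qed.

Lemma cvg_half_pow (R : realType) : (2^-1 ^+ n : R) @[n --> \oo] --> (0 : R).
Proof.
have := @cvg_geometric R 1 2^-1; rewrite ger0_norm// invf_lt1// ltr1n.
by rewrite /geometric/= => /(_ isT); under eq_fun do rewrite mul1r.
Qed.

Section Continuity.
Variables (R : realType) (L : language R).
Implicit Types (M N : structure L) (G : seq (lsort L)).

(* A failure of uniform continuity gives two sequences that become equal in a *)
(* nonprincipal ultrapower, where their images are different.                 *)
Lemma eval_unif_cont M G (phi : formula G) (e : R) : 0 < e ->
  exists2 d : R, 0 < d & forall x y : tup M G,
    tdist x y < d -> `|eval phi x - eval phi y| < e.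
Proof.
move=> e0; apply: contrapT => nd.
have /choice[p pP] : forall n, exists p : tup M G * tup M G,
    tdist p.1 p.2 < 2^-1 ^+ n /\ e <= `|eval phi p.1 - eval phi p.2|.
  move=> n; apply: contrapT => np; apply: nd; exists (2^-1 ^+ n).
    by rewrite exprn_gt0.
  by move=> x y xy; rewrite ltNge; apply/negP => exy; apply: np; exists (x, y).
have [U UU nU] := nonprincipal_exists.
pose u n := (p n).1; pose v n := (p n).2.
have uv : tpi UU u = tpi UU v.
  apply: (@tdist_eq0 _ _ (ultrapower M UU)); apply/eqP; rewrite eq_le tdist_ge0 andbT.
  apply: (ler_cvg_to (@tdist_tpi _ _ _ _ UU _ u v)
    (nonprincipal_cvg UU nU (@cvg_half_pow R))).
  by apply: (@filterE _ U) => n; have [/ltW] := pP n.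
have : `|eval phi (u n) - eval phi (v n)| @[n --> U] -->
    `|eval phi (tpi UU u : tup (ultrapower M UU) G) -
      eval phi (tpi UU v : tup (ultrapower M UU) G)|.
  by apply: cvg_norm; apply: cvgB; exact: los.
rewrite uv subrr normr0 => uv0.
have : \forall n \near U, `|eval phi (u n) - eval phi (v n)| < e.
  exact: (cvgr_lt _ uv0).
move=> /filter_ex[n]; have [_] := pP n.
by move=> /le_lt_trans/[apply]; rewrite ltxx.
Qed.

End Continuity.

Section Elementary.
Variables (R : realType) (L : language R).
Implicit Types (M N : structure L) (G : seq (lsort L)).

Definition elementary M N (h : forall s, M s -> N s) :=
  forall G (phi : formula G) (x : tup M G), eval phi (tmap h x) = eval phi x.

Lemma elementary_mdist M N (h : forall s, M s -> N s) s (x y : M s) :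
  elementary h -> mdist (h s x) (h s y) = mdist x y.
Proof.
move=> h_el.
exact: (h_el [:: s; s] (Fdist (Tvar (V0 s [:: s])) (Tvar (VS s (V0 s [::]))))
  (x, (y, tt))).
Qed.

Lemma elementary_models M N (h : forall s, M s -> N s) (T : theory L) :
  elementary h -> models M T <-> models N T.
Proof.
move=> h_el; split=> MT sigma /MT; first by rewrite -(h_el [::] sigma tt).
by rewrite (h_el [::] sigma tt).
Qed.

Lemma terms_eval_tmap M N (h : forall s, M s -> N s) :
  (forall f (x : tup M (fdom f)), h _ (fint M f x) = fint N f (tmap h x)) ->
  forall G D (ts : terms G D) (x : tup M G),
    terms_eval (tmap h x) ts = tmap h (terms_eval x ts).
Proof.
move=> h_fun G D ts x.
apply: (@terms_mut R L G (fun s t => term_eval (tmap h x) t = h s (term_eval x t))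
  (fun D ts => terms_eval (tmap h x) ts = tmap h (terms_eval x ts))).
- by move=> s v /=; elim: v x => //= {}s t {}G v IH x; rewrite IH.
- by move=> f {}ts IH /=; rewrite IH h_fun.
- by [].
- by move=> s {}D t IHt {}ts IHts /=; rewrite IHt IHts.
Qed.

Definition fneg G (psi : formula (L := L) G) : formula G :=
  Fconn (n := 1) (u := fun v : 'rV[R]_1 => - v ord0 ord0)
    (fun v => cvgN (@coord_continuous _ 1 1 ord0 ord0 v)) (fun=> psi).

Lemma eval_fneg M G (psi : formula G) (x : tup M G) :
  eval (fneg psi) x = - eval psi x.
Proof. by rewrite /= mxE. Qed.

Let sup_range_eq (T T' : pointedType) (h : T -> T') (b : R) (f : T' -> R)
    (g : T -> R) : (forall y, `|f y| <= b) -> (forall x, f (h x) = g x) ->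
  (forall (e : R) y, 0 < e -> exists x, f y <= f (h x) + e) ->
  sup (range f) = sup (range g).
Proof.
move=> fb fg fh; have gb x : `|g x| <= b by rewrite -fg.
apply/eqP; rewrite eq_le; apply/andP; split.
  apply: sup_range_le => y; apply/ler_addgt0Pr => e /(fh e y)[x yx].
  by rewrite (le_trans yx)// lerD2r fg; exact: le_sup_range gb x.
apply: sup_range_le => x.
by rewrite -fg; exact: le_sup_range fb _.
Qed.

(** The test supplies near-minimizers in the image of [h]; suprema are handled by applying it to
    [fneg psi]. *)
Lemma tarski_vaught_test M N (h : forall s, M s -> N s) :
  (forall s (x y : M s), mdist (h s x) (h s y) = mdist x y) ->
  (forall f (x : tup M (fdom f)), h _ (fint M f x) = fint N f (tmap h x)) ->
  (forall p (x : tup M (pdom p)), pint N p (tmap h x) = pint M p x) ->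
  (forall s G (psi : formula (s :: G)) (x : tup M G) (b : N s) (e : R), 0 < e ->
    exists a, eval psi ((h s a, tmap h x) : tup N (s :: G)) <=
      eval psi ((b, tmap h x) : tup N (s :: G)) + e) ->
  elementary h.
Proof.
move=> h_dist h_fun h_pred h_test G phi; have h_terms := terms_eval_tmap h_fun.
elim: G / phi => [G s t1 t2|G p ts|G n f cf phis IH|G s psi IH|G s psi IH] x /=.
- have h_term t : term_eval (tmap h x) t = h s (term_eval x t).
    by case: (h_terms _ _ (Tcons t (Tnil G)) x).
  by rewrite !h_term h_dist.
- by rewrite h_terms h_pred.
- by congr f; apply/rowP => i; rewrite !mxE.
- have [b bP] := eval_bounded N psi.
  apply: (@sup_range_eq (M s) (N s) (h s) b).
  + by move=> y; exact: bP.
  + by move=> a; exact: (IH (a, x)).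
  + move=> e y e0; have [a] := h_test s G (fneg psi) x y e e0.
    by rewrite !eval_fneg => ya; exists a; lra.
- have [b bP] := eval_bounded N psi.
  rewrite !inf_range; congr (- _); apply: (@sup_range_eq (M s) (N s) (h s) b).
  + by move=> y; rewrite normrN; exact: bP.
  + by move=> a; congr (- _); exact: (IH (a, x)).
  + move=> e y e0; have [a aP] := h_test s G psi x y e e0.
    by exists a; rewrite lerNl opprD opprK lerBlDr.
Qed.

Lemma isomorphic_elementary M N : isomorphic M N ->
  exists2 h : forall s, M s -> N s, elementary h &
    forall s (b : N s), exists a, h s a = b.
Proof.
move=> [h [h_bij h_iso h_fun h_pred]].
have h_surj s (b : N s) : exists a, h s a = b.
  by have [k _ hk] := h_bij s; exists (k b).
exists h => //; apply: tarski_vaught_test => // s G psi x b e e0.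
by have [a <-] := h_surj s b; exists a; rewrite lerDl ltW.
Qed.

Lemma models_ultrapower M (U : set_system nat) (UU : UltraFilter U) (T : theory L) :
  models M T -> models (ultrapower M UU) T.
Proof.
move=> MT sigma Ts; apply: (ulim_cvg_unique UU (los UU sigma (fun=> tt))).
by under eq_fun do rewrite MT//; exact: cvg_cst.
Qed.

Section Definable.
Variables (T : theory L) (G : seq (lsort L)) (P : forall M, tup M G -> R).
Hypothesis P_def : definable_formula T P.
Arguments P : clear implicits.

Let approx (e : R) : 0 < e -> exists phi : formula G,
  forall M, models M T -> forall x : tup M G, `|P M x - eval phi x| <= e.
Proof.
move=> e0; have [phi phiP] := P_def; have /filter_ex[n nP] := phiP e e0.
by exists (phi n).
Qed.

Lemma definable_elementary M N (h : forall s, M s -> N s) (x : tup M G) :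
  elementary h -> models M T -> P N (tmap h x) = P M x.
Proof.
move=> h_el MT; have NT := (elementary_models T h_el).1 MT.
apply/eqP; rewrite -subr_eq0 -normr_le0; apply/ler_addgt0Pr => e e0.
have e20 : 0 < e / 2 by rewrite divr_gt0.
have [phi phiP] := approx e20.
have := phiP N NT (tmap h x); rewrite h_el => PN.
rewrite add0r (splitr e) (le_trans (ler_distD (eval phi x) _ _))//.
by rewrite lerD// distrC phiP.
Qed.

(** The ultrapower is again a model of [T], so a single formula approximates [P] both there and in
    [M], and [los] transfers its values. *)
Lemma definable_los M (U : set_system nat) (UU : UltraFilter U)
    (u : nat -> tup M G) : models M T ->
  P M (u n) @[n --> U] --> P (ultrapower M UU) (tpi UU u).
Proof.
move=> MT; apply/cvgrPdist_lt => e e0.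
have e30 : 0 < e / 3 by rewrite divr_gt0.
have [phi phiP] := approx e30.
have /cvgrPdist_lt/(_ _ e30) := los UU phi u; apply: filterS => n un.
have := phiP _ (models_ultrapower UU MT) (tpi UU u).
have := phiP M MT (u n); rewrite (distrC (P M _)) => u1 u2.
have -> : e = e / 3 + e / 3 + e / 3 by lra.
rewrite (le_lt_trans (ler_distD (eval phi (u n)) _ _))// ltr_leD//.
rewrite (le_lt_trans (ler_distD (eval phi (tpi UU u : tup (ultrapower M UU) G)) _ _))//.
by rewrite ler_ltD.
Qed.

Lemma definable_unif_cont M (e : R) : models M T -> 0 < e ->
  exists2 d : R, 0 < d & forall x y : tup M G,
    tdist x y < d -> `|P M x - P M y| < e.
Proof.
move=> MT e0; have e30 : 0 < e / 3 by rewrite divr_gt0.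
have [phi phiP] := approx e30; have [d d0 dP] := eval_unif_cont M phi e30.
exists d => // x y /dP xy; have -> : e = e / 3 + e / 3 + e / 3 by lra.
have := phiP M MT y; rewrite (distrC (P M _)) => yP.
rewrite (le_lt_trans (ler_distD (eval phi y) _ _))// ltr_leD//.
rewrite (le_lt_trans (ler_distD (eval phi x) _ _))//.
by rewrite ler_ltD// phiP.
Qed.

End Definable.
End Elementary.

Arguments definable_los {R L T G P} P_def {M U} UU u.
Arguments definable_elementary {R L T G P} P_def {M N h} x.
Arguments definable_unif_cont {R L T G P} P_def {M e}.

(** * Elementary substructures *)

(** The point and the closure condition make the subtype a pointed complete metric space, hence a
    possible sort. *)
Record closed_subset (R : realType) (T : completeMetricType R) := ClosedSubset {
  cset : set T;
  cpoint : T;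
  cpointP : cset cpoint;
  cclosedP : forall x, (forall e : R, 0 < e -> exists2 y, cset y & mdist x y < e) ->
    cset x }.

Section ClosedSubset.
Variables (R : realType) (T : completeMetricType R) (A : closed_subset T).

Definition subsort := {x : T | cset A x}.

HB.instance Definition _ := gen_eqMixin subsort.
HB.instance Definition _ := gen_choiceMixin subsort.

Let subdist (x y : subsort) : R := mdist (sval x) (sval y).

Let subdist_eq0 x y : subdist x y = 0 -> x = y.
Proof. by case: x y => [x ?] [y ?] /mdist_positivity; exact: eq_exist. Qed.

HB.instance Definition _ := @isMetric.Build R subsort subdist
  (fun x => mdistxx _) subdist_eq0 (fun x y => metric_sym _ _)
  (fun y x z => metric_triangle _ _ _).

HB.instance Definition _ := isPointed.Build subsort (exist _ _ (cpointP A)).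

Lemma subsort_complete (F : set_system subsort) :
  ProperFilter F -> cauchy F -> cvg F.
Proof.
move=> FF /cauchyP Fc.
have FvF : ProperFilter (sval @ F) by exact: fmap_proper_filter.
have /cvg_ex[l Fl] : cvg (sval @ F).
  apply: cauchy_cvg; apply: cauchy_exP => e e0; have [x Fx] := Fc e e0.
  by exists (sval x); apply: filterS Fx => y; rewrite !ballEmdist => xy; exact: xy.
have near_l e : 0 < e -> F [set x | mdist l (sval x) < e].
  by move=> e0; have /metricType_numDomainType.cvgrPdist_lt/(_ _ e0) := Fl.
have Al : cset A l.
  apply: cclosedP => e /near_l/filter_ex[x lx]; exists (sval x) => //.
  exact: svalP.
apply/cvg_ex; exists (exist _ l Al : subsort).
apply/(@metricType_numDomainType.cvgrPdist_lt _ subsort _ _ _ id) => e.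
exact: near_l.
Qed.

HB.instance Definition _ := Uniform_isComplete.Build subsort subsort_complete.

End ClosedSubset.

Section TarskiVaught.
Variables (R : realType) (L : language R) (N : structure L).
Implicit Types (M : structure L) (G : seq (lsort L)).

Fixpoint tall (S : forall s, set (N s)) G : tup N G -> Prop :=
  match G return tup N G -> Prop with
  | [::] => fun=> True
  | s :: G' => fun x => S s x.1 /\ tall S x.2
  end.

Definition tarski_vaught_set (S : forall s, set (N s)) :=
  forall s G (psi : formula (s :: G)) (x : tup N G) (e : R),
    tall S x -> 0 < e ->
    exists2 a, S s a & eval psi ((a, x) : tup N (s :: G)) <= eval (Finf psi) x + e.

Definition mclosure (S : forall s, set (N s)) s :=
  [set a : N s | forall e : R, 0 < e -> exists2 b, S s b & mdist a b < e].

Lemma tall_mclosure_near S G (x : tup N G) (e : R) : 0 < e ->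
  tall (mclosure S) x -> exists2 y, tall S y & tdist x y < e.
Proof.
move=> e0; elim: G x => [x _|s G IH [a x] /= [/(_ _ e0)[b Sb ab]]].
  by exists tt.
by move=> /IH[y Sy xy]; exists (b, y) => //=; rewrite gt_max ab.
Qed.

Section Substructure.
Variable C : forall s, closed_subset (N s).
Let K : lsort L -> completeMetricType R := fun s => subsort (C s).
Let incl s : K s -> N s := sval.
Hypothesis C_fun : forall f (x : tup K (fdom f)),
  cset (C (fcod f)) (fint N f (tmap incl x)).

Let tdist_incl G (x y : tup K G) : tdist (tmap incl x) (tmap incl y) = tdist x y.
Proof. by elim: G x y => //= s G IH x y; rewrite IH. Qed.

Let kfint f (x : tup K (fdom f)) : K (fcod f) := exist _ _ (C_fun x).
Let kpint p (x : tup K (pdom p)) : R := pint N p (tmap incl x).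

Let ksbound s (x y : K s) : mdist x y <= sbound s.
Proof. exact: sboundP. Qed.

Let kfmod f (e : {posnum R}) (x y : tup K (fdom f)) :
  tdist x y < (fmod f e)%:num -> mdist (kfint x) (kfint y) <= e%:num.
Proof. by rewrite -tdist_incl; exact: fmodP. Qed.

Let kpmod p (e : {posnum R}) (x y : tup K (pdom p)) :
  tdist x y < (pmod p e)%:num -> `|kpint x - kpint y| <= e%:num.
Proof. by rewrite -tdist_incl; exact: pmodP. Qed.

Let kpbound p (x : tup K (pdom p)) : `|kpint x| <= pbound p.
Proof. exact: pboundP. Qed.

Definition substructure : structure L :=
  @Structure R L K kfint kpint ksbound kfmod kpmod kpbound.

Definition substructure_incl s : substructure s -> N s := @incl s.
End Substructure.

Fixpoint tvars (G D : seq (lsort L)) :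
    (forall s, var D s -> var G s) -> terms G D :=
  match D return (forall s, var D s -> var G s) -> terms G D with
  | [::] => fun=> Tnil G
  | s :: D' => fun w => Tcons (Tvar (w s (V0 s D')))
      (tvars (fun t v => w t (VS s v)))
  end.

Lemma terms_eval_tvars M G D (w : forall s, var D s -> var G s)
    (x : tup M G) (y : tup M D) :
  (forall s (v : var D s), lookup (w s v) x = lookup v y) ->
  terms_eval x (tvars w) = y.
Proof.
elim: D w y => [w []//|s D IH] w [y1 y2] wxy /=.
rewrite (wxy _ (V0 s D)) /=; congr pair; apply: IH => t v.
by rewrite (wxy _ (VS s v)).
Qed.

Lemma eval_inf_le M G s (psi : formula (s :: G)) (a : M s) (x : tup M G) :
  eval (Finf psi) x <= eval psi ((a, x) : tup M (s :: G)).
Proof.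
have [b bP] := eval_bounded M psi.
rewrite /= inf_range lerNl; apply: (@le_sup_range R (M s) b
  (fun a => - eval psi ((a, x) : tup M (s :: G)))) => y.
by rewrite normrN; exact: bP.
Qed.

Theorem tarski_vaught_substructure (S : forall s, set (N s)) : tarski_vaught_set S ->
  exists (M : structure L) (h : forall s, M s -> N s), elementary h /\
    forall s (b : N s), mclosure S b <-> exists a, h s a = b.
Proof.
move=> S_tv.
(* Uniform continuity of [psi] and of its infimum carries the test from [S] to its closure. *)
have tv s G (psi : formula (s :: G)) (x : tup N G) (e : R) :
    tall (mclosure S) x -> 0 < e ->
    exists2 a, mclosure S a &
      eval psi ((a, x) : tup N (s :: G)) <= eval (Finf psi) x + e.
  move=> Sx e0; have e30 : 0 < e / 3 by rewrite divr_gt0.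
  have [d d0 dP] := eval_unif_cont N psi e30.
  have [d' d'0 d'P] := eval_unif_cont N (Finf psi) e30.
  have dd'0 : 0 < Num.min d d' by rewrite lt_min d0.
  have [y Sy xy] := tall_mclosure_near dd'0 Sx.
  have [a Sa aP] := S_tv s G psi y (e / 3) Sy e30.
  exists a; first by move=> c c0; exists a; rewrite ?mdistxx.
  move: xy; rewrite lt_min => /andP[/= xyd xyd'].
  have : `|eval psi ((a, x) : tup N (s :: G)) - eval psi ((a, y) : tup N (s :: G))|
      < e / 3 by apply: dP; rewrite /= mdistxx max_r// tdist_ge0.
  have := d'P _ _ xyd'; rewrite !ltr_norml => /andP[h1 h2] /andP[h3 h4].
  by lra.
have S0 s : exists a, S s a.
  pose psi := Fdist (Tvar (V0 s [::])) (Tvar (V0 s [::])).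
  have [//|a Sa _] := S_tv s [::] psi tt 1 _ ltr01.
  by exists a.
have C_closed s (x : N s) :
    (forall e : R, 0 < e -> exists2 y, mclosure S y & mdist x y < e) ->
    mclosure S x.
  move=> xS e e0; have e20 : 0 < e / 2 by rewrite divr_gt0.
  have [y /(_ _ e20)[z Sz yz] xy] := xS _ e20; exists z => //.
  by rewrite (splitr e) (le_lt_trans (metric_triangle _ y _))// ltrD.
have S_C s (a : N s) : S s a -> mclosure S a.
  by move=> Sa e e0; exists a; rewrite ?mdistxx.
pose C s := ClosedSubset (S_C s _ (svalP (cid (S0 s)))) (@C_closed s).
pose incl s : subsort (C s) -> N s := sval.
have C_tall G (x : tup (fun s => subsort (C s)) G) :
    tall (mclosure S) (tmap incl x).
  by elim: G x => //= s G IH [[a Ca] x].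
(* The test is applied to the distance between the value of [f] and a variable: its infimum is 0, so
   the closure has points arbitrarily near that value. *)
have C_fun f (x : tup (fun s => subsort (C s)) (fdom f)) :
    cset (C (fcod f)) (fint N f (tmap incl x)).
  set y := tmap _ x; apply: cclosedP => e e0; have e20 : 0 < e / 2 by rewrite divr_gt0.
  pose w s (v : var (fdom f) s) := VS (fcod f) v.
  pose psi := Fdist (Tfun (tvars w)) (Tvar (V0 (fcod f) (fdom f))).
  have [a Ca aP] := tv _ _ psi y (e / 2) (C_tall _ x) e20; exists a => //.
  have psiE b : eval psi ((b, y) : tup N (_ :: _)) = mdist (fint N f y) b.
    by rewrite /= (terms_eval_tvars (y := y)).
  have := eval_inf_le psi (fint N f y) y; rewrite psiE mdistxx => inf0.
  by rewrite -psiE (le_lt_trans aP)//; lra.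
exists (substructure C_fun), (@substructure_incl C C_fun); split.
  apply: tarski_vaught_test => // s G psi x b e e0.
  have [a Ca aP] := tv s G psi (tmap incl x) e (C_tall _ x) e0.
  exists (exist _ a Ca); rewrite (le_trans aP)// lerD2r.
  exact: eval_inf_le.
move=> s b; split=> [Sb|[[a Ca] <-]]; last exact: Ca.
by exists (exist _ b Sb).
Qed.
End TarskiVaught.

(** * Separable models *)

Lemma countable_inj T U (A : set T) (B : set U) (f : T -> U) :
  set_fun A B f -> set_inj A f -> countable B -> countable A.
Proof.
move=> fAB f_inj /card_leE[g _ g_inj]; apply/card_leE; exists (g \o f) => //.
move=> x y Ax Ay /= /g_inj fxy; apply: f_inj => //.
by apply: fxy; rewrite inE; apply: fAB; exact/set_mem.
Qed.

Section CountableModel.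
Variables (R : realType) (L : language R) (T : theory L).
Implicit Types (M : structure L) (G : seq (lsort L)).

Definition separable M := exists2 S : forall s, set (M s),
  forall s, countable (S s) &
  forall s (a : M s) (e : R), 0 < e -> exists2 b, S s b & mdist a b < e.

Lemma eval_inf_near M G s (psi : formula (s :: G)) (x : tup M G) (e : R) :
  0 < e -> exists a : M s,
    eval psi ((a, x) : tup M (s :: G)) <= eval (Finf psi) x + e.
Proof.
move=> e0; have [b bP] := eval_bounded M psi.
have [||a aP] := @sup_range_near R (M s) b
    (fun a => - eval psi ((a, x) : tup M (s :: G))) _ e.
- by move=> a; rewrite normrN; exact: bP.
- exact: e0.
- by exists a; rewrite /= inf_range; lra.
Qed.

Section Countable.
Variable D : forall G, set (formula (L := L) G).
Arguments D : clear implicits.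
Hypothesis D_countable :
  countable [set p : {G & formula G} | D (projT1 p) (projT2 p)].

Let pformula := {p : lsort L * seq (lsort L) & formula (p.1 :: p.2)}.
Let pD := [set p : pformula | D _ (projT2 p)].

Let pD_countable : countable pD.
Proof.
pose f (p : pformula) : {G & formula (L := L) G} :=
  existT (fun G => formula G) ((projT1 p).1 :: (projT1 p).2) (projT2 p).
pose g (q : {G & formula (L := L) G}) : option pformula :=
  match q with existT G psi =>
    match G return formula G -> option pformula with
    | [::] => fun=> None
    | s :: G' => fun psi => Some (existT _ (s, G') psi)
    end psi end.
have fK : pcancel f g by move=> [[s G] psi].
by apply: (@countable_inj _ _ _ _ f) D_countable => // p q _ _ /(pcan_inj fK).
Qed.

Lemma lsort_countable : (forall G, exists psi, D G psi) ->
  countable [set: lsort L].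
Proof.
move=> /(_ [:: _]) D0.
pose psi s := sval (cid (D0 s)).
apply: (@countable_inj _ _ _ _
  (fun s => existT (fun G => formula G) [:: s] (psi s))) D_countable.
  by move=> s _; exact: (svalP (cid (D0 s))).
by move=> s t _ _ /(congr1 (@projT1 _ _)) [].
Qed.

Variable M : structure L.
Hypothesis M_T : models M T.
Hypothesis D_dense : forall G (phi : formula G) (e : R), 0 < e ->
  exists2 psi, D G psi & forall M, models M T ->
    forall x : tup M G, `|eval phi x - eval psi x| <= e.

Lemma tall_countable (S : forall s, set (M s)) G :
  (forall s, countable (S s)) -> countable [set x : tup M G | tall S x].
Proof.
move=> cS; elim: G => [|s G IH]; first exact: (@countableP unit).
exact: (countableX (cS s) IH).
Qed.

Let half_gt0 n : 0 < 2^-1 ^+ n :> R.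
Proof. by rewrite exprn_gt0. Qed.

Let wit (p : pformula) n (x : tup M (projT1 p).2) : M (projT1 p).1 :=
  sval (cid (eval_inf_near (projT2 p) x (half_gt0 n))).

Let witP s G (psi : formula (s :: G)) n (x : tup M G) :
  eval psi ((@wit (existT _ (s, G) psi) n x, x) : tup M (s :: G)) <=
    eval (Finf psi) x + 2^-1 ^+ n.
Proof. by rewrite /wit; case: cid. Qed.

Let fiber (S : set {s & M s}) s := [set a : M s | S (existT _ s a)].

Let fiber_countable S s : countable S -> countable (@fiber S s).
Proof.
apply: (@countable_inj _ _ _ _ (existT (fun s => M s) s)) => // a b _ _.
pose g (q : {s & M s}) := if pselect (projT1 q = s) is left e
  then eq_rect _ (fun s => M s : Type) (projT2 q) _ e else point.
move=> /(congr1 g); rewrite /g /=; case: pselect => // e.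
by rewrite (Prop_irrelevance e erefl).
Qed.

Let step (S : set {s & M s}) := S `|` \bigcup_(p in pD) \bigcup_n
  ((fun x => existT (fun s => M s) _ (@wit p n x)) @` [set x | tall (fiber S) x]).

Let stage k := iter k step set0.

Let stage_countable k : countable (stage k).
Proof.
elim: k => [|k IH]; first exact: countable0.
rewrite /stage iterS -/(stage k) /step -bigcup2E.
apply: bigcup_countable => // -[|[|i]] _ /=.
- exact: IH.
- apply: bigcup_countable => // p _; apply: bigcup_countable => // n _.
  apply: (sub_countable (card_image_le _ _)).
  by apply: tall_countable => s; exact: fiber_countable.
- exact: countable0.
Qed.

Let stage_mono k l : (k <= l)%N -> stage k `<=` stage l.
Proof.
move=> /subnK <-; elim: (l - k)%N => // n IH; rewrite addSn => q /IH.
by rewrite /stage iterS; left.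
Qed.

Let limit s := [set a : M s | exists k, fiber (stage k) a].

Let tall_limit G (x : tup M G) : tall limit x -> exists k, tall (fiber (stage k)) x.
Proof.
elim: G x => [|s G IH] x /=; first by exists 0%N.
have mono k l H (y : tup M H) : (k <= l)%N ->
    tall (fiber (stage k)) y -> tall (fiber (stage l)) y.
  move=> kl; elim: H y => //= t H IH' y [y1 y2]; split; last exact: IH'.
  exact: stage_mono kl _ y1.
move=> [[k x1] /IH[l x2]]; exists (maxn k l); split.
  exact: stage_mono (leq_maxl k l) _ x1.
exact: mono (leq_maxr k l) x2.
Qed.

(** Downward Loewenheim-Skolem: near-minimizers are adjoined only for the countably many formulas of
    [D], and density of [D] extends the test to all formulas. *)
Lemma countable_tarski_vaught_set : exists2 S : forall s, set (M s),
  forall s, countable (S s) & tarski_vaught_set S.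
Proof.
exists limit => [s|s G psi x e].
  have -> : @limit s = \bigcup_k @fiber (stage k) s.
    by apply/seteqP; split=> a [k]; exists k.
  by apply: bigcup_countable => // k _; exact: fiber_countable.
(* The four errors of [e / 4] are: replacing [psi] by [psi'] at the witness and again at [b], the
   precision of the witness, and that of [b]. *)
move=> /tall_limit[k xk] e0; have e40 : 0 < e / 4 by rewrite divr_gt0.
have [psi' Dpsi' /(_ M M_T) psiP] := D_dense psi e40.
have [n] := small_geometric 1 e40; rewrite mul1r => ne.
exists (@wit (existT _ (s, G) psi') n x).
  exists k.+1; rewrite /fiber /stage /= /step; right.
  by exists (existT _ (s, G) psi') => //; exists n => //; exists x.
have [b bP] := eval_inf_near psi x e40.
have := witP psi' n x; have := eval_inf_le psi' b x.
have := psiP ((@wit (existT _ (s, G) psi') n x, x) : tup M (s :: G)).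
have := psiP ((b, x) : tup M (s :: G)).
rewrite !ler_norml => /andP[h1 h2] /andP[h3 h4] h5 h6.
by lra.
Qed.

End Countable.

Theorem separable_model : (exists M, models M T) -> countable_density T ->
  countable [set: lsort L] /\ exists2 M, models M T & separable M.
Proof.
move=> [M MT] [D cD D_dense]; split.
  apply: (lsort_countable cD) => G.
  (* A connective of arity 0 gives a formula in every context; approximating it shows [D] nonempty
     there. *)
  pose phi : formula G := Fconn (n := 0) (u := fun=> 0)
    (fun v => @cst_continuous _ _ (0 : R) v)
    (fun i => False_rect _ (notF (ltn_ord i))).
  by have [psi Dpsi _] := D_dense G phi 1 ltr01; exists psi.
have [S cS S_tv] := countable_tarski_vaught_set cD MT D_dense.
have [N [h [h_el hS]]] := tarski_vaught_substructure S_tv.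
exists N; first exact/(elementary_models T h_el).
exists (fun s => h s @^-1` S s) => s.
  apply: (@countable_inj _ _ _ _ (h s)) (cS s) => // a b _ _ ab.
  by apply: mdist_positivity; rewrite -(elementary_mdist _ _ h_el) ab mdistxx.
move=> a e e0; have /(_ e e0)[b Sb ab] : mclosure S (h s a) by apply/hS; exists a.
have [c cb] : exists c, h s c = b.
  by apply/hS => d d0; exists b; rewrite ?mdistxx.
exists c; first by rewrite /= cb.
by rewrite -(elementary_mdist _ _ h_el) cb.
Qed.

End CountableModel.

(** * The hull of a family of functions *)

(** [r k p] means that [k] codes [p]. A triple is determined by countably many yes-or-no facts (the
    number and the length of the list, membership in its sets, the graph of the function), hence by
    one set of naturals. *)
Lemma sequence_code_card_le T (A : set T)
    (r : nat * seq (set nat) * (seq nat -> nat) -> T -> Prop) :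
  (forall p, A p -> exists k, r k p) ->
  (forall k p q, r k p -> r k q -> p = q) -> A #<= continuum.
Proof.
move=> rA r_inj.
pose in_code (k : nat * seq (set nat) * (seq nat -> nat))
    (t : nat * nat + (nat * nat + seq nat * nat)) : Prop :=
  match t with
  | inl p => p = (k.1.1, size k.1.2)
  | inr (inl p) => nth set0 k.1.2 p.1 p.2
  | inr (inr p) => k.2 p.1 = p.2
  end.
pose code k := pickle @` [set t | in_code k t].
have in_codeE k k' t : code k = code k' -> in_code k t -> in_code k' t.
  move=> kk' kt; have : code k' (pickle t) by rewrite -kk'; exists t.
  by move=> [t' /= k't'] /(pcan_inj pickleK) <-.
have code_inj : injective code.
  move=> [[n ws] h] [[n' ws'] h'] kk'.
  have [-> sz] := in_codeE _ _ (inl (n, size ws)) kk' erefl.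
  congr (_, _, _).
    apply: (eq_from_nth (x0 := set0)) => // i _; apply/seteqP; split=> x.
      exact: (in_codeE _ _ (inr (inl (i, x))) kk').
    exact: (in_codeE _ _ (inr (inl (i, x))) (esym kk')).
  by apply/funext => l; have := in_codeE _ _ (inr (inr (l, h l))) kk' erefl.
have /choice[f fP] : forall p, exists k, A p -> r k p.
  move=> p; have [/rA[k kp]|nAp] := pselect (A p); first by exists k.
  by exists (0%N, [::], fun=> 0%N).
apply/card_leE; exists (code \o f) => //.
move=> p q /set_mem Ap /set_mem Aq /code_inj fpq.
by apply: (r_inj (f p)); [exact: fP|rewrite fpq; exact: fP].
Qed.

Section Hull.
Variables (R : realType) (L : language R) (M : structure L).
Variables (rho : nat -> set nat -> nat) (U : set_system nat) (UU : UltraFilter U).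
Variable W : set (set nat).
Implicit Types (G : seq (lsort L)).
Notation MU := (ultrapower M UU).

(* The classes of the sequences [i |-> h (rho i w_1, ..., rho i w_m)] with    *)
(* [w_1, ..., w_m] in [W]; arbitrary functions [h] serve as Skolem functions. *)
Definition hull s := [set a : MU s | exists (ws : seq (set nat))
  (h : seq nat -> M s), (forall w, w \in ws -> W w) /\
  a = upi _ UU (fun i => h (map (rho i) ws))].

(** The lists supporting the entries of a tuple are concatenated, and each function reads its own
    block through [take] and [drop], so one list serves the whole tuple. *)
Lemma tall_hullP G (x : tup MU G) : tall hull x <->
  exists (ws : seq (set nat)) (h : seq nat -> tup M G),
    (forall w, w \in ws -> W w) /\ x = tpi UU (fun i => h (map (rho i) ws)).
Proof.
split; last first.
  move=> [ws [h [wsW ->]]]; elim: G h {x} => //= s G IH h; split.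
    by exists ws, (fun l => (h l).1).
  exact: (IH (fun l => (h l).2)).
elim: G x => [[] _|s G IH [a x] /= [[vs [f [vsW ->]]] /IH[ws [h [wsW ->]]]]].
  by exists [::], (fun=> tt).
exists (vs ++ ws), (fun l => (f (take (size vs) l), h (drop (size vs) l))); split.
  by move=> w; rewrite mem_cat => /orP[/vsW|/wsW].
congr pair; [congr upi|congr tpi]; apply/funext => i; rewrite map_cat /=.
  by rewrite take_size_cat// size_map.
by rewrite drop_size_cat// size_map.
Qed.

(** A near-minimizer [f l] chosen in [M] for each parameter [h l] is a function of the same list
    [ws], so its class stays in the hull. *)
Lemma hull_tarski_vaught : tarski_vaught_set hull.
Proof.
move=> s G psi x e /tall_hullP[ws [h [wsW ->]]] e0.
have /choice[f fP] := fun l => eval_inf_near psi (h l) e0.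
exists (upi _ UU (fun i => f (map (rho i) ws))); first by exists ws, f.
have := los UU psi (fun i => (f (map (rho i) ws), h (map (rho i) ws))).
have := los UU (Finf psi) (fun i => h (map (rho i) ws)).
move=> /cvgD/(_ (cvg_cst e)) l1 l2.
apply: (ler_cvg_to l2 l1); apply: (@filterE _ U) => i; exact: fP.
Qed.

Section HullModel.
Variables (A : structure L) (iota : forall s, A s -> MU s).
Hypothesis iota_elementary : elementary iota.
Hypothesis iota_range : forall s (b : MU s),
  mclosure hull b <-> exists a, iota a = b.

Lemma hull_lift G (x : tup MU G) : tall hull x -> exists y, tmap iota y = x.
Proof.
elim: G x => [[]|s G IH [b x] /= [hb /IH[y <-]]]; first by exists tt.
have [a <-] : exists a, iota a = b.
  by apply/iota_range => e e0; exists b; rewrite ?mdistxx.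
by exists (a, y).
Qed.

Lemma hull_density : countable [set: lsort L] -> separable M ->
  density_char_le A continuum.
Proof.
move=> cL [S cS S_dense].
have [k _ k_inj] := (card_leE _ _).1 cL.
have /all_sig[enum enumP] : forall s, {f : nat -> M s | S s `<=` range f}.
  by move=> s; apply: cid; have /pcard_surjP[f fS] := cS s; exists f => a /fS.
pose D s := [set a : A s | exists (ws : seq (set nat)) (h : seq nat -> nat),
  iota a = upi _ UU (fun i => enum s (h (map (rho i) ws)))].
exists D.
- move=> s O [a Oa] Oop.
  have /nbhs_ballP[e /= e0 aeO] := open_nbhs_nbhs (conj Oop Oa).
  have e20 : 0 < e / 2 by rewrite divr_gt0.
  have /(_ _ e20)[b [ws [h [wsW bE]]] ab] : mclosure hull (iota a).
    by apply/iota_range; exists a.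
  (* Rounding the values of [h] to the enumerated dense set turns [h] into a function with values in
     [nat], which fits the coding by triples. *)
  have /choice[h' h'P] : forall l, exists n, mdist (h l) (enum s n) < e / 2.
    move=> l; have [c /enumP[n _ <-] lc] := S_dense s (h l) _ e20.
    by exists n.
  pose c : MU s := upi _ UU (fun i => enum s (h' (map (rho i) ws))).
  have [a' a'c] : exists a', iota a' = c.
    apply/iota_range => d d0; exists c; rewrite ?mdistxx//.
    by exists ws, (fun l => enum s (h' l)).
  exists a'; split; last by exists ws, h'.
  apply: aeO; rewrite ballEmdist /= -(elementary_mdist _ _ iota_elementary) a'c.
  rewrite (le_lt_trans (metric_triangle _ b _))// (splitr e) ltr_leD// bE.
  rewrite mdist_upi.
  have <- : ulim U (fun=> e / 2) = e / 2 by apply: ulim_eq; exact: cvg_cst.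
  apply: (@ulim_le _ _ UU _ _ (sbound s) `|e / 2|) => //.
    by move=> i; rewrite ger0_norm ?mdist_ge0//; exact: sboundP.
  by apply: (@filterE _ U) => i; exact/ltW/h'P.
- pose r (c : nat * seq (set nat) * (seq nat -> nat)) (p : {s & A s}) :=
    k (projT1 p) = c.1.1 /\
    iota (projT2 p) = upi _ UU (fun i => enum _ (c.2 (map (rho i) c.1.2))).
  apply: (@sequence_code_card_le _ _ r) => [[s a] [ws [h /= ah]]|].
    by exists (k s, ws, h).
  move=> c [s a] [t b] [/= ks ac] [/= kt bc].
  have st : s = t by apply: k_inj; rewrite ?inE// ks kt.
  subst t; congr existT; apply: mdist_positivity.
  by rewrite -(elementary_mdist _ _ iota_elementary) ac bc mdistxx.
Qed.

End HullModel.
End Hull.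

(** * Scales *)

Section Scales.
Variables (R : realType) (L : language R) (T : theory L) (G : seq (lsort L)).
Variable X : forall M : structure L, set (tup M G).
Hypothesis X_definable : definable_set T X.
Variable phi : forall M : structure L, tup M (G ++ G) -> R.
Hypothesis phi_definable : definable_formula T phi.
Arguments X : clear implicits.
Arguments phi : clear implicits.
Hypothesis phi_discrete : forall M, models M T ->
  forall a b : tup M G, X M a -> X M b ->
    phi M (tcat a b) = 0 \/ phi M (tcat a b) = 1.
Hypothesis phi_asymmetric : forall M, models M T ->
  forall a b : tup M G, X M a -> X M b ->
    phi M (tcat a b) = 0 -> phi M (tcat b a) = 1.
Hypothesis phi_bound : forall M, models M T ->
  forall (n : nat) (a : 'I_n -> tup M G), (forall i, X M (a i)) ->
    exists2 b : tup M G, X M b & forall i, phi M (tcat (a i) b) = 0.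
Implicit Types (M N : structure L).

Lemma X_nonempty M : models M T -> X M !=set0.
Proof.
move=> MT; have [|b Xb _] := phi_bound MT (n := 0)
  (a := fun i => False_rect _ (notF (ltn_ord i))); last by exists b.
by move=> [].
Qed.

(** [X] is the zero set of its distance function, which is definable and therefore preserved by
    elementary maps. *)
Lemma X_elementary M N (h : forall s, M s -> N s) (x : tup M G) :
  elementary h -> models M T -> X N (tmap h x) <-> X M x.
Proof.
move=> h_el MT; have NT := (elementary_models T h_el).1 MT.
have [Xc Xd] := X_definable.
rewrite (set_dist_eq0 (X_nonempty MT) _ (Xc M MT)).
rewrite (set_dist_eq0 (X_nonempty NT) _ (Xc N NT)).
by rewrite (definable_elementary Xd x h_el MT).
Qed.

Section Ultrapower.
Variables (M : structure L) (U : set_system nat) (UU : UltraFilter U).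
Hypothesis M_T : models M T.
Notation MU := (ultrapower M UU).

Lemma X_tpi (u : nat -> tup M G) : (forall n, X M (u n)) -> X MU (tpi UU u).
Proof.
move=> uX; have [Xc Xd] := X_definable; have MUT := models_ultrapower UU M_T.
apply/(set_dist_eq0 (X_nonempty MUT) _ (Xc MU MUT)).
apply: (ulim_cvg_unique UU (definable_los Xd UU u M_T)).
have -> : (fun n => set_dist (u n) (X M)) = fun=> 0.
  by apply/funext => n; apply/(set_dist_eq0 (X_nonempty M_T) _ (Xc M M_T)).
exact: cvg_cst.
Qed.

Lemma set_dist_tpi_cvg (u : nat -> tup M G) :
  set_dist (u n) (X M) @[n --> U] --> set_dist (tpi UU u : tup MU G) (X MU).
Proof. by have [_ Xd] := X_definable; exact: (definable_los Xd UU u M_T). Qed.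
Arguments set_dist_tpi_cvg : clear implicits.

(** Each coordinate of a representative is moved to a point of [X M] within [2^-1 ^+ n] of the
    optimal distance; the moves tend to 0 along [U], so the class is unchanged. *)
Lemma X_tpi_repr (y : tup MU G) : nonprincipal U -> X MU y ->
  exists2 u : nat -> tup M G, (forall n, X M (u n)) & y = tpi UU u.
Proof.
move=> nU Xy; have [Xc Xd] := X_definable; have MUT := models_ultrapower UU M_T.
have /choice[u uP] : forall n, exists z, X M z /\
    tdist (trepr y n) z < set_dist (trepr y n) (X M) + 2^-1 ^+ n.
  move=> n; have n0 : 0 < 2^-1 ^+ n :> R by rewrite exprn_gt0.
  by have [z Xz yz] := set_dist_near (X_nonempty M_T) (trepr y n) n0; exists z.
exists u => [n|]; first by have [] := uP n.
rewrite -{1}(treprK y); apply: (@tdist_eq0 _ _ MU); apply/eqP.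
rewrite eq_le tdist_ge0 andbT.
have l2 : set_dist (trepr y n) (X M) + 2^-1 ^+ n @[n --> U] --> set_dist y (X MU) + 0.
  apply: cvgD; last exact: nonprincipal_cvg nU (@cvg_half_pow R).
  by rewrite -{2}(treprK y); exact: set_dist_tpi_cvg.
rewrite ((set_dist_eq0 (X_nonempty MUT) _ (Xc MU MUT)).1 Xy) addr0 in l2.
apply: (ler_cvg_to (@tdist_tpi _ _ _ _ UU _ (trepr y) u) l2).
by apply: (@filterE _ U) => n; have [_ /ltW] := uP n.
Qed.

Lemma phi_tpi_eq0 (u v : nat -> tup M G) :
  U [set n | phi M (tcat (u n) (v n)) = 0] ->
  phi MU (tcat (tpi UU u) (tpi UU v)) = 0.
Proof.
move=> uv; rewrite -tpi_tcat.
have := definable_los phi_definable UU (fun n => tcat (u n) (v n)) M_T.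
by move=> /(ulim_cvg_unique UU); apply; exact: cvg_near_cst uv.
Qed.

End Ultrapower.
Arguments set_dist_tpi_cvg {M U} UU M_T u.

(* As [phi] is discrete on [X], its zeros there are stable under small moves. *)
Lemma phi_near M : models M T -> exists2 d : R, 0 < d &
  forall x y b : tup M G, X M x -> X M b -> tdist x y < d ->
    phi M (tcat y b) = 0 -> phi M (tcat x b) = 0.
Proof.
move=> MT; have [d d0 dP] := definable_unif_cont phi_definable MT ltr01.
exists d => // x y b Xx Xb xy yb0.
have := dP (tcat x b) (tcat y b); rewrite tdist_tcat tdistxx max_l ?tdist_ge0//.
by move=> /(_ xy); rewrite yb0 subr0; case: (phi_discrete MT Xx Xb) => -> //;
  rewrite normr1 ltxx.
Qed.

Lemma dominating_sequence M : models M T -> separable M ->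
  exists2 g : nat -> tup M G, (forall j, X M (g j)) &
    forall x, X M x ->
      exists J, forall j, (J <= j)%N -> phi M (tcat x (g j)) = 0.
Proof.
move=> MT [S cS S_dense].
have X0 := X_nonempty MT; have [x0 Xx0] := X0.
have /choice[r rP] : forall p : tup M G * nat, exists z, X M z /\
    tdist p.1 z < set_dist p.1 (X M) + 2^-1 ^+ p.2.
  move=> p; have n0 : 0 < 2^-1 ^+ p.2 :> R by rewrite exprn_gt0.
  by have [z Xz pz] := set_dist_near X0 p.1 n0; exists z.
(* Nearly closest points of [X] to a countable dense set of tuples: a countable set, dense in
   [X M]. *)
pose Y := r @` ([set x | tall S x] `*` [set: nat]).
have : countable Y.
  apply: (sub_countable (card_image_le _ _)); apply: countableX => //.
  exact: tall_countable.
move=> /card_leE[f _ f_inj].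
have /choice[y yP] : forall k, exists z, forall z', Y z' -> f z' = k -> z = z'.
  move=> k; have [[z [Yz <-]]|nz] := pselect (exists z, Y z /\ f z = k).
    by exists z => z' Yz' /esym zz'; apply: f_inj; rewrite ?inE.
  by exists x0 => z' Yz' z'k; case: nz; exists z'.
have /choice[g gP] : forall j, exists z, X M z /\
    forall i, (i < j)%N -> X M (y i) -> phi M (tcat (y i) z) = 0.
  (* [y i] is unconstrained when [i] is not a code, so [x0] stands in for values outside [X]. *)
  move=> j; pose a (i : 'I_j) := if `[< X M (y i) >] then y i else x0.
  have [i|z Xz az] := phi_bound MT (a := a); first by rewrite /a; case: asboolP.
  exists z; split=> // i ij Xy; have := az (Ordinal ij).
  by rewrite /a asboolT.
exists g => [j|x Xx]; first by have [] := gP j.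
have [d d0 dP] := phi_near MT; have d40 : 0 < d / 4 by rewrite divr_gt0.
have xS : tall (mclosure S) x.
  elim: (G) x {Xx} => //= s H IH x; split=> // e e0; exact: S_dense.
have [z Sz xz] := tall_mclosure_near d40 xS.
have [n] := small_geometric 1 d40; rewrite mul1r => nd.
have [Xr zr] := rP (z, n).
have [k yk] : exists k, y k = r (z, n).
  by exists (f (r (z, n))); apply: yP => //; exists (z, n).
exists k.+1 => j kj; have [Xg /(_ k kj)] := gP j; rewrite yk => /(_ Xr) rg.
apply: (dP _ _ _ Xx Xg _ rg).
have := set_dist_le X0 z Xx; rewrite tdist_sym => zx; move: zr => /= zr.
by rewrite (le_lt_trans (tdist_triangle z _ _))//; lra.
Qed.

(** * Scales and their transfer *)

Section Scale.
Variable lt : set nat -> set nat -> Prop.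
Hypothesis lt_wo : strict_well_order lt.

Definition countably_directed (W : set (set nat)) :=
  forall Z, Z `<=` W -> countable Z -> exists2 w, W w & forall z, Z z -> lt z w.

Definition scale M (W : set (set nat)) (alpha : set nat -> tup M G) :=
  (forall w, W w -> X M (alpha w)) /\
  forall x, X M x -> exists2 w0, W w0 &
    forall w, W w -> lt w0 w -> phi M (tcat x (alpha w)) = 0.

(** A point of [X A] is close to a class given by finitely many [rho i v], and [g] dominates its
    coordinates from an index depending only on those numbers. For [w] above all these [v],
    [rho i w] exceeds that index for [U]-almost all [i]. *)
Lemma model_with_scale (W : set (set nat)) :
  countably_directed W -> (exists M, models M T) -> countable_density T ->
  exists2 A, models A T & density_char_le A continuum /\
    exists alpha : set nat -> tup A G, scale W alpha.
Proof.
move=> W_dir T_model /(separable_model T_model)[cL [M MT sM]].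
have [rho [U [UU U_fast]]] := fast_growing_ultrafilter lt_wo.
have [g gX g_dom] := dominating_sequence MT sM.
pose MU := ultrapower M UU; have MUT : models MU T := models_ultrapower UU MT.
have [A [iota [iota_el iota_range]]] :=
  tarski_vaught_substructure (@hull_tarski_vaught _ _ M rho U UU W).
have AT : models A T by exact/(elementary_models T iota_el).
exists A => //; split; first exact: (hull_density iota_el iota_range).
have /choice[alpha alphaP] : forall w, exists a : tup A G, W w ->
    tmap iota a = tpi UU (fun i => g (rho i w)).
  move=> w; have [Ww|nWw] := pselect (W w); last first.
    have [a _] := X_nonempty AT; by exists a.
  have [|a aE] := hull_lift iota_range (x := tpi UU (fun i => g (rho i w)) : tup MU G).
    apply/tall_hullP; exists [:: w], (fun l => g (head 0%N l)); split=> //.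
    by move=> v; rewrite inE => /eqP ->.
  by exists a.
have alphaX w : W w -> X MU (tmap iota (alpha w)).
  by move=> /alphaP ->; exact: X_tpi.
exists alpha; split=> [w Ww|x Xx].
  by apply/(X_elementary _ iota_el AT); exact: alphaX.
have XNx : X MU (tmap iota x) by exact/(X_elementary _ iota_el AT).
have [d d0 dP] := phi_near MUT; have d30 : 0 < d / 3 by rewrite divr_gt0.
have xS : tall (mclosure (@hull _ _ M rho U UU W)) (tmap iota x).
  elim: (G) x {Xx XNx} => //= s H IH x; split=> //.
  by apply/iota_range; exists x.1.
have [z /tall_hullP[ws [h [wsW ->]]] xz] := tall_mclosure_near d30 xS.
(* The values of [h] are moved into [X], since [g] dominates only points of [X]; [H l] is the index
   from which it dominates [q l]. *)
have /choice[q qP] : forall l, exists y, X M y /\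
    tdist (h l) y < set_dist (h l) (X M) + d / 3.
  by move=> l; have [y Xy hy] := set_dist_near (X_nonempty MT) (h l) d30; exists y.
have /choice[H HP] := fun l => g_dom (q l) (qP l).1.
pose hs i := h (map (rho i) ws); pose qs i := q (map (rho i) ws).
(* [hs] is within [d / 3] of the point of [X] given by [x], so rounding [hs] into [X] costs less
   than two more thirds. *)
have xQ : tdist (tmap iota x) (tpi UU qs : tup MU G) < d.
  have l2 : set_dist (hs i) (X M) + d / 3 @[i --> U] -->
      set_dist (tpi UU hs : tup MU G) (X MU) + d / 3.
    by apply: cvgD (set_dist_tpi_cvg UU MT _) (cvg_cst _).
  have hq : \forall i \near U, tdist (hs i) (qs i) <= set_dist (hs i) (X M) + d / 3.
    by apply: (@filterE _ U) => i; have [_ /ltW] := qP (map (rho i) ws).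
  have hQ : tdist (tpi UU hs : tup MU G) (tpi UU qs) <=
      set_dist (tpi UU hs : tup MU G) (X MU) + d / 3.
    exact: (ler_cvg_to (@tdist_tpi _ _ _ _ UU _ hs qs) l2 hq).
  have hx := set_dist_le (X_nonempty MUT) (tpi UU hs : tup MU G) XNx.
  rewrite tdist_sym in hx.
  apply: (le_lt_trans (tdist_triangle (tpi UU hs : tup MU G) _ _)).
  have lt_d (a b c : R) : a < d / 3 -> b <= c + d / 3 -> c <= a -> a + b < d.
    by move=> *; lra.
  exact: (lt_d _ _ _ xz hQ hx).
have [w0 Ww0 w0P] : exists2 w, W w & forall v, [set` ws] v -> lt v w.
  by apply: W_dir => [v /wsW//|]; exact/finite_set_countable/finite_seq.
exists w0 => // w Ww w0w; rewrite -(definable_elementary phi_definable _ iota_el AT).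
rewrite tmap_tcat; apply: (dP _ _ _ XNx (alphaX w Ww) xQ).
rewrite alphaP//; apply: phi_tpi_eq0 => //.
apply: filterS (U_fast w ws H _) => [i /= Hi|v vws]; first exact: HP.
by apply: (swo_trans lt_wo _ w0w); exact: w0P.
Qed.

(** A point of [X] upstairs is the class of a sequence in [X M]; the countably many thresholds of
    its terms have a common bound in [W]. *)
Lemma scale_ultrapower M (W : set (set nat)) (alpha : set nat -> tup M G)
    (U : set_system nat) (UU : UltraFilter U) : countably_directed W -> models M T ->
  nonprincipal U -> scale W alpha ->
  scale (M := ultrapower M UU) W (fun w => tpi UU (fun=> alpha w)).
Proof.
move=> W_dir MT nU [alphaX alphaP]; split=> [w Ww|x Xx].
  by apply: X_tpi => // _; exact: alphaX.
have [u uX ->] := X_tpi_repr MT nU Xx.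
have /choice[w wP] : forall n, exists w, W w /\
    forall v, W v -> lt w v -> phi M (tcat (u n) (alpha v)) = 0.
  by move=> n; have [w Ww wP] := alphaP _ (uX n); exists w.
have [w0 Ww0 w0P] : exists2 w0, W w0 & forall v, range w v -> lt v w0.
  apply: W_dir => [_ [n _ <-]|]; first by have [] := wP n.
  by apply: (sub_countable (card_image_le _ _)); exact: countableP.
exists w0 => // v Wv w0v; apply: phi_tpi_eq0 => //; apply: (@filterE _ U) => n /=.
by apply: (wP n).2 => //; apply: (swo_trans lt_wo _ w0v); apply: w0P; exists n.
Qed.

Lemma scale_surjective M N (h : forall s, M s -> N s) (W : set (set nat))
    (alpha : set nat -> tup M G) :
  elementary h -> (forall s (b : N s), exists a, h s a = b) -> models M T ->
  scale W alpha -> scale W (fun w => tmap h (alpha w)).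
Proof.
move=> h_el h_surj MT [alphaX alphaP]; split=> [w Ww|y].
  by apply/(X_elementary _ h_el MT); exact: alphaX.
have [x <-] : exists x, tmap h x = y.
  elim: (G) y => [[]|s H IH [b y]]; first by exists tt.
  by have [a <-] := h_surj s b; have [x <-] := IH y; exists (a, x).
move=> /(X_elementary _ h_el MT)/alphaP[w0 Ww0 w0P]; exists w0 => // w Ww w0w.
by rewrite -tmap_tcat (definable_elementary phi_definable _ h_el MT) w0P.
Qed.

(** Each [alpha w] has a threshold [f w] in [W2]. These thresholds number at most [W1], so some [v]
    is beyond them all and [beta v] lies above every [alpha w]; but late terms of [alpha] lie above
    [beta v]. *)
Lemma scales_incompatible M (W1 W2 : set (set nat))
    (alpha beta : set nat -> tup M G) :
  models M T -> countably_directed W1 ->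
  (forall Z, Z `<=` W2 -> Z #<= W1 ->
    exists2 w, W2 w & forall z, Z z -> lt z w) ->
  scale W1 alpha -> scale W2 beta -> False.
Proof.
move=> MT W1_dir W2_dir [alphaX alphaP] [betaX betaP].
have /choice[f fP] : forall w, exists v, W1 w -> W2 v /\
    forall v', W2 v' -> lt v v' -> phi M (tcat (alpha w) (beta v')) = 0.
  move=> w; have [Ww|] := pselect (W1 w); last by exists set0.
  by have [v Wv vP] := betaP _ (alphaX _ Ww); exists v.
have [v Wv vP] : exists2 v, W2 v & forall z, (f @` W1) z -> lt z v.
  apply: W2_dir; first by move=> _ [w /fP[] ? _ <-].
  exact: card_image_le.
have [w0 Ww0 w0P] := alphaP _ (betaX _ Wv).
have [w Ww w0w] : exists2 w, W1 w & forall z, [set w0] z -> lt z w.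
  by apply: W1_dir => [_ ->//|]; exact: countable1.
have wv : phi M (tcat (alpha w) (beta v)) = 0.
  by apply: (fP w Ww).2 => //; apply: vP; exists w.
have := phi_asymmetric MT (alphaX _ Ww) (betaX _ Wv) wv.
by rewrite (w0P w Ww (w0w _ erefl)) => /esym/eqP; rewrite oner_eq0.
Qed.

End Scale.
End Scales.

Theorem theorem3p1 (R : realType) (L : language R) (T : theory L)
    (T_complete : complete_theory T)
    (T_density : countable_density T)
    (G : seq (lsort L))
    (X : forall M : structure L, set (tup M G))
    (X_definable : definable_set T X)
    (phi : forall M : structure L, tup M (G ++ G) -> R)
    (phi_definable : definable_formula T phi)
    (phi_discrete : forall M : structure L, models M T ->
      forall a b : tup M G, X M a -> X M b ->
        phi M (tcat a b) = 0 \/ phi M (tcat a b) = 1)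
    (phi_asymmetric : forall M : structure L, models M T ->
      forall a b : tup M G, X M a -> X M b ->
        phi M (tcat a b) = 0 -> phi M (tcat b a) = 1)
    (phi_bound : forall M : structure L, models M T ->
      forall (n : nat) (a : 'I_n -> tup M G), (forall i, X M (a i)) ->
        exists2 b : tup M G, X M b & forall i, phi M (tcat (a i) b) = 0)
    (not_CH : ~ continuum_hypothesis) :
  exists A B : structure L,
    [/\ models A T, models B T,
        density_char_le A continuum, density_char_le B continuum &
        forall (U V : set_system nat)
          (UU : UltraFilter U) (VV : UltraFilter V),
          nonprincipal U -> nonprincipal V ->
          ~ isomorphic (ultrapower A UU) (ultrapower B VV)].
Proof.
have [T_model _] := T_complete.
have [lt [W1 [W2 [lt_wo W1_dir W2_dir W2_W1]]]] := not_CH_orders not_CH.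
have mws := model_with_scale X_definable phi_definable phi_discrete phi_bound lt_wo.
have [A AT [dA [alpha alphaP]]] := mws W1 W1_dir T_model T_density.
have [B BT [dB [beta betaP]]] := mws W2 W2_dir T_model T_density.
exists A, B; split=> // U V UU VV nU nV /isomorphic_elementary[h h_el h_surj].
have su := scale_ultrapower X_definable phi_definable phi_bound lt_wo.
have AUT := models_ultrapower UU AT.
(* Both scales meet in the ultrapower of [B]: [beta] as constant sequences, [alpha] as constant
   sequences carried over by the isomorphism. *)
apply: (scales_incompatible phi_asymmetric (models_ultrapower VV BT) W1_dir W2_W1
  _ (su _ _ _ _ VV W2_dir BT nV betaP)).
exact: (scale_surjective X_definable phi_definable phi_bound h_el h_surj AUT
  (su _ _ _ _ UU W1_dir AT nU alphaP)).
Qed.
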